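(* Let $M=(M_k)\in\mathbb R_{>0}^{\mathbb N}$ and let $U\subseteq\mathbb R^n$ be open. (1) If $\liminf_k M_k^{1/k}>0$ then $\mathcal E^{\{M\}}(U)=\mathcal E^{\{M^{b(c)}\}}(U)$. (2) If $\lim_k M_k^{1/k}=\infty$ then $\mathcal E^{(M)}(U)=\mathcal E^{(M^{b(c)})}(U)$. Under the assumption of (1), $\mathcal E^{\{M\}}(U)$ is an algebra, and under the assumption of (2), $\mathcal E^{(M)}(U)$ is an algebra.
   Context: For $M\in\mathbb R_{>0}^{\mathbb N}$, open $U\subseteq\mathbb R^n$, compact $K\subseteq U$, $\rho>0$ and $f\in C^\infty(U,\mathbb R)$ let $\|f\|^M_{K,\rho}:=\sup\{\|f^{(k)}(x)\|_{L^k(\mathbb R^n,\mathbb R)}/(k!\rho^kM_k):x\in K,k\in\mathbb N\}$ ($f^{(k)}$ the $k$-th Fréchet derivative). $\mathcal E^{(M)}(U)$: smooth $f$ with $\|f\|^M_{K,\rho}<\infty$ for all compact $K\subseteq U$ and all $\rho>0$; $\mathcal E^{\{M\}}(U)$: smooth $f$ such that for every compact $K$ some $\rho>0$ gives $\|f\|^M_{K,\rho}<\infty$. For $M$ with $(k!M_k)^{1/k}\to\infty$ (which holds under either hypothesis), $T_M(t):=\sup_{k}t^k/(k!M_k)$ for $t>0$ and $M^{b(c)}_k:=\frac1{k!}\sup_{t>0}t^k/T_M(t)$; $(k!M^{b(c)}_k)_k$ is the largest log-convex minorant of $(k!M_k)_k$. *)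

(* Defs.v *)
From HB Require Import structures.
From mathcomp Require Import all_boot all_order all_algebra.
From mathcomp Require Import all_classical all_reals all_analysis.
Set Implicit Arguments. Unset Strict Implicit. Unset Printing Implicit Defensive.
Import Order.TTheory GRing.Theory Num.Theory.
Import numFieldNormedType.Exports.
Local Open Scope classical_set_scope.
Local Open Scope ring_scope.

Section DenjoyCarleman.
Variables (R : realType) (n : nat).
Local Notation V := 'rV[R]_n.

Definition eucl_norm (v : V) : R := Num.sqrt (\sum_(i < n) (v ord0 i) ^+ 2).

(* iterated directional derivative  d_{v1} d_{v2} ... d_{vk} f,
   i.e. x |-> f^(k)(x)(v1,...,vk) for smooth f *)
Fixpoint iderive (f : V -> R) (vs : seq V) : V -> R :=
  match vs with
  | [::] => f
  | v :: vs' => 'D_v (iderive f vs')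
  end.

Definition smooth_on (U : set V) (f : V -> R) : Prop :=
  forall vs : seq V,
    {in U, continuous (iderive f vs)} /\
    (forall v x, U x -> derivable (iderive f vs) x v).

Definition unit_vecs (vs : seq V) : Prop := forall v, v \in vs -> eucl_norm v <= 1.

(* ||f||^M_{K,rho} = sup_{x in K, k} ||f^(k)(x)||_{L^k} / (k! rho^k M_k),
   with ||f^(k)(x)||_{L^k} = sup_{|v_i| <= 1} |f^(k)(x)(v_1,..,v_k)|. *)
Definition seminormM (M : nat -> R) (K : set V) (rho : R) (f : V -> R) : \bar R :=
  ereal_sup [set y | exists x k vs,
     [/\ K x, size vs = k, unit_vecs vs &
         y = (`|iderive f vs x| / (k`!%:R * rho ^+ k * M k))%:E]].

Definition E_Beurling (M : nat -> R) (U : set V) : set (V -> R) :=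
  [set f | smooth_on U f /\
     forall K : set V, K `<=` U -> compact K ->
       forall rho : R, 0 < rho -> (seminormM M K rho f < +oo)%E].

Definition E_Roumieu (M : nat -> R) (U : set V) : set (V -> R) :=
  [set f | smooth_on U f /\
     forall K : set V, K `<=` U -> compact K ->
       exists rho : R, 0 < rho /\ (seminormM M K rho f < +oo)%E].

Definition is_fun_algebra (S : set (V -> R)) : Prop :=
  [/\ S (fun _ => 1),
      forall f g, S f -> S g -> S (f \+ g),
      forall (a : R) f, S f -> S (fun x => a * f x) &
      forall f g, S f -> S g -> S (f \* g)].

End DenjoyCarleman.

Section Mbc.
Variable R : realType.

(* T_M(t) = sup_k t^k / (k! M_k)   (real sup; finite under the hypotheses) *)
Definition TM (M : nat -> R) (t : R) : R :=
  sup (range (fun k : nat => t ^+ k / (k`!%:R * M k))).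

Definition Mbc (M : nat -> R) (k : nat) : R :=
  k`!%:R^-1 * sup [set t ^+ k / TM M t | t in [set t : R | 0 < t]].

Definition Mroot (M : nat -> R) (k : nat) : R := M k `^ (k%:R^-1).

End Mbc.

(* Main.v *)
Require Import Defs.
From HB Require Import structures.
From mathcomp Require Import all_boot all_order all_algebra.
From mathcomp Require Import all_classical all_reals all_analysis.
From mathcomp Require Import ring lra zify.
Set Implicit Arguments.
Unset Strict Implicit.
Import Order.TTheory GRing.Theory Num.Theory.
Import numFieldNormedType.Exports.
Local Open Scope classical_set_scope.
Local Open Scope ring_scope.

(** The inclusion of the space for [M] in the one for [Mbc M] rests on an
    inequality of Cartan and Gorny without the factor [(N/j)^j] that one gets
    on a whole interval: if [|g| <= A] and [|g^(N)| <= A tau^N] on an interval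
    of half-length [N / (e tau)], then [|g^(j)| <= 2 A (e tau)^j] at its centre.
    Indeed the Taylor polynomial of degree [< N] is bounded by [2 A] there, and
    among polynomials with a given bound the Chebyshev polynomials maximise the
    derivatives at the centre.  In several variables one treats the coordinate
    directions one after the other, and a general direction is a combination of
    coordinate ones, at the price of a factor [n^k].

    Write [m_k = k! M_k].  Given [k], take a slope [t] such that [2 t] is
    steeper and [t] is not steeper than the convex minorant of [ln m] at [k].
    This gives [p <= k < q] with [T_M(t) = t^p / m_p] and
    [m_q <= m_p (2 t)^(q-p)]; interpolating between the derivatives of orders
    [p] and [q] bounds the one of order [k] by
    [C (c rho)^k t^k / T_M(t) <= C (c rho)^k k! Mbc_k].  The growth
    condition on [M] makes the interval needed for this fit into a fixed
    neighbourhood of the compact set.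

    The space for [Mbc M] is an algebra by Leibniz' rule, because
    [t^i s^j <= max(t, s)^(i+j)] implies
    [(i! Mbc_i) (j! Mbc_j) <= Mbc_0 (i+j)! Mbc_(i+j)]. *)

(** * Coefficients of bounded polynomials *)

Section ChebyshevCoefficients.
Variable R : realType.
Implicit Types (p q E W : {poly R}) (y : nat -> R).

(** One more factor ['X - (F j)%:P] adds a shift of the coefficients to their multiple by [- F j],
    and both contributions keep the alternation of signs. *)
Lemma coef_prod_XsubC_ge0 (I : Type) (s : seq I) (P : pred I) (F : I -> R) i :
  (forall j, 0 <= F j) ->
  0 <= (-1) ^+ (count P s + i) * (\prod_(j <- s | P j) ('X - (F j)%:P))`_i.
Proof.
move=> F0; elim: s i => [|a s IH] i.
  rewrite big_nil coef1 /=; case: i => [|i]; first by rewrite expr0 mulr1 ler01.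
  by rewrite mulr0.
rewrite big_cons /=; case: (P a) => /=; last exact: IH.
rewrite mulrBl coefB coefXM coefCM add1n addSn exprS mulN1r mulNr mulrBr opprB.
apply: addr_ge0; first by rewrite mulrCA mulr_ge0.
case: i => [|i] /=; first by rewrite mulr0 oppr0.
by rewrite addnS exprS mulN1r mulNr opprK.
Qed.

Lemma count_predC1_ord m (k : 'I_m.+1) :
  count (fun l => l != k) (index_enum 'I_m.+1) = m.
Proof. by rewrite -sum1_count sum1_card cardC1 card_ord. Qed.

(** The difference of the two sides has size at most [m.+1] and vanishes at [m.+1] distinct
    nodes. *)
Lemma lagrange_expansion m y W : {in gtn m.+1 &, injective y} ->
  (size W <= m.+1)%N ->
  W = \sum_(k < m.+1) (W.[y k] / \prod_(l < m.+1 | l != k) (y k - y l)) *: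
        \prod_(l < m.+1 | l != k) ('X - (y l)%:P).
Proof.
move=> yinj sW.
have yneq (k l : 'I_m.+1) : l != k -> y k - y l != 0.
  move=> lk; rewrite subr_eq0; apply/eqP => /yinj ykl; move/negP: lk; apply.
  by apply/eqP/val_inj/esym/ykl; rewrite inE.
apply/eqP; rewrite -subr_eq0; set D := _ - _.
apply/eqP/(@roots_geq_poly_eq0 _ D [seq y (nat_of_ord k) | k <- enum 'I_m.+1]).
- apply/allP => _ /mapP[k _ ->]; rewrite rootE /D hornerD hornerN horner_sum.
  rewrite (bigD1 k)//= [X in _ - (_ + X)]big1 ?addr0.
    rewrite hornerZ.
    have -> : (\prod_(l < m.+1 | l != k) ('X - (y l)%:P)).[y k] =
              \prod_(l < m.+1 | l != k) (y k - y l).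
      by rewrite horner_prod; apply: eq_bigr => l _; rewrite hornerXsubC.
    rewrite divfK ?subrr//; apply/prodf_neq0 => l lk; exact: yneq.
  move=> l lk; rewrite hornerZ [X in _ * X = _](_ : _ = 0) ?mulr0//.
  by rewrite horner_prod (bigD1 k) 1?eq_sym//= hornerXsubC subrr mul0r.
- rewrite map_inj_in_uniq ?enum_uniq// => k l _ _ ykl.
  by apply/val_inj/yinj; rewrite ?inE ?ltn_ord.
- rewrite size_map size_enum_ord (leq_trans (size_polyD _ _))// geq_max sW.
  rewrite size_polyN (leq_trans (size_sum _ _ _))//; apply/bigmax_leqP => k _.
  rewrite (leq_trans (size_scale_leq _ _))//.
  by rewrite -big_filter size_prod_XsubC size_filter count_predC1_ord.
Qed.

Lemma normr_signM_ge0 n (x : R) : 0 <= (-1) ^+ n * x -> x = (-1) ^+ n * `|x|.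
Proof.
by move=> h; rewrite -(normrMsign n) (ger0_norm h) mulrA -expr2 sqrr_sign mul1r.
Qed.

(** Exactly the [k] factors with [l < k] are negative. *)
Lemma prod_sub_decreasing_sign m y (k : 'I_m.+1) :
  (forall i j, (i < j <= m)%N -> y j < y i) ->
  0 <= (-1) ^+ k * \prod_(l < m.+1 | l != k) (y k - y l).
Proof.
move=> ydec.
have -> : (-1) ^+ k = \prod_(l < m.+1 | l != k) (if (l < k)%N then -1 else 1) :> R.
  have km : (k <= m.+1)%N by rewrite ltnW.
  rewrite -[in LHS](card_ord k) -prodr_const (big_ord_widen _ (fun=> -1) km).
  by rewrite big_mkcond (bigD1 k)//= ltnn mul1r.
rewrite -big_split /=; apply: prodr_ge0 => l lk; case: ifPn => lk'.
  by rewrite mulN1r opprB subr_ge0 ltW// ydec// lk' -ltnS ltn_ord.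
rewrite mul1r subr_ge0 ltW// ydec// -(ltnS l) ltn_ord andbT ltn_neqAle.
by rewrite eq_sym lk leqNgt.
Qed.

(* All the terms of the Lagrange expansion of [E`_i] have the same sign. *)
Lemma coef_le_alternating m y (c : nat -> R) E W (A : R) i :
  (forall i, 0 <= y i) -> (forall i j, (i < j <= m)%N -> y j < y i) ->
  (forall k, 0 <= c k) ->
  (size E <= m.+1)%N -> (size W <= m.+1)%N ->
  (forall k, (k <= m)%N -> E.[y k] = (-1) ^+ k * c k) ->
  (forall k, (k <= m)%N -> `|W.[y k]| <= A * c k) ->
  `|W`_i| <= A * `|E`_i|.
Proof.
move=> y0 ydec c0 sE sW Ey Wy.
have yinj : {in gtn m.+1 &, injective y}.
  move=> a b; rewrite !inE !ltnS => am bm yab; case: (ltngtP a b) => // ab.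
    by have := ydec a b; rewrite ab bm yab ltxx => /(_ isT).
  by have := ydec b a; rewrite ab am yab ltxx => /(_ isT).
pose L (k : 'I_m.+1) := \prod_(l < m.+1 | l != k) ('X - (y l)%:P).
pose w (k : 'I_m.+1) := \prod_(l < m.+1 | l != k) (y k - y l).
(* The sign of the coefficient of [L k] does not depend on [k], while the sign of [w k] cancels that
   of [E.[y k]]. *)
have LE k : (L k)`_i = (-1) ^+ (m + i) * `|(L k)`_i|.
  apply: normr_signM_ge0; rewrite -{1}(count_predC1_ord k).
  exact: coef_prod_XsubC_ge0.
have wE k : w k = (-1) ^+ k * `|w k|.
  exact/normr_signM_ge0/prod_sub_decreasing_sign.
have expand p : (size p <= m.+1)%N ->
    p`_i = \sum_(k < m.+1) p.[y k] / w k * (L k)`_i.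
  move=> sp; rewrite {1}(lagrange_expansion yinj sp) coef_sum.
  by apply: eq_bigr => k _; rewrite coefZ.
have EE : E`_i = (-1) ^+ (m + i) * \sum_(k < m.+1) c k / `|w k| * `|(L k)`_i|.
  rewrite expand// mulr_sumr; apply: eq_bigr => k _.
  rewrite Ey -1?ltnS ?ltn_ord//; have := LE k; have := wE k.
  move: (L k)`_i (w k) => l v -> ->; rewrite !normrM !normr_sign !mul1r !normr_id.
  rewrite invfM invr_sign [X in X * _ = _]mulrACA -expr2 sqrr_sign mul1r.
  by rewrite mulrCA.
have -> : `|E`_i| = \sum_(k < m.+1) c k / `|w k| * `|(L k)`_i|.
  rewrite EE normrM normr_sign mul1r ger0_norm//; apply: sumr_ge0 => k _.
  by rewrite mulr_ge0// divr_ge0.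
(* For [W] the triangle inequality bounds each term by [A] times the corresponding term of the sum
   for [E]. *)
rewrite expand// (le_trans (ler_norm_sum _ _ _))//.
rewrite mulr_sumr; apply: ler_sum => k _.
rewrite !normrM normfV !mulrA ler_wpM2r// ler_wpM2r ?invr_ge0//.
by rewrite Wy// -ltnS ltn_ord.
Qed.

(** The Chebyshev polynomials of the first kind. *)
Fixpoint cheb (n : nat) : {poly R} :=
  match n with
  | 0 => 1
  | 1 => 'X
  | (n'.+1 as n1).+1 => 'X * cheb n1 *+ 2 - cheb n'
  end.

Lemma chebSS n : cheb n.+2 = 'X * cheb n.+1 *+ 2 - cheb n. Proof. by []. Qed.

Lemma nat_ind2 (P : nat -> Prop) :
  P 0%N -> P 1%N -> (forall n, P n -> P n.+1 -> P n.+2) -> forall n, P n.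
Proof.
move=> P0 P1 PS n; suff [] : P n /\ P n.+1 by [].
by elim: n => // n [Pn PSn]; split=> //; exact: PS.
Qed.

Lemma cheb_cos n (a : R) : (cheb n).[cos a] = cos (a *+ n).
Proof.
elim/nat_ind2: n => [||n IH0 IH1].
- by rewrite mulr0n cos0 hornerC.
- by rewrite hornerX.
rewrite chebSS hornerD hornerN hornerMn hornerM hornerX IH0 IH1.
have -> : a *+ n.+2 = a *+ n.+1 + a by rewrite [in LHS]mulrSr.
have -> : a *+ n = a *+ n.+1 - a by rewrite mulrSr addrK.
by rewrite cosB cosD mulr2n; ring.
Qed.

Lemma size_cheb n : (size (cheb n) <= n.+1)%N.
Proof.
elim/nat_ind2: n => [||n IH0 IH1]; rewrite ?size_poly1 ?size_polyX//.
rewrite chebSS (leq_trans (size_polyD _ _))// geq_max size_polyN.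
rewrite (leq_trans IH0 (leqW (leqnSn _))) andbT mulr2n (leq_trans (size_polyD _ _))//.
by rewrite maxnn (leq_trans (size_polyMleq _ _))// size_polyX.
Qed.

Lemma cosDpin (a : R) n : cos (a + pi *+ n) = (-1) ^+ n * cos a.
Proof.
elim: n => [|n IH]; first by rewrite mulr0n addr0 mul1r.
by rewrite mulrSr addrA cosDpi IH exprS mulN1r mulNr.
Qed.

Lemma bernoulli_pow (x : R) j : 1 <= x -> x ^+ j.+1 <= (x - 1) ^+ j.+1 + j.+1%:R * x ^+ j.
Proof.
move=> x1; elim: j => [|j IH]; first by rewrite !expr1 mul1r expr0 subrK.
have xj : 0 <= x ^+ j by rewrite exprn_ge0//; lra.
rewrite exprS (exprS (x - 1)) -[j.+2%:R]natr1 (exprS _ j).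
have : 0 <= (x - 1) ^+ j.+1 by rewrite exprn_ge0//; lra.
move: IH; rewrite exprS; set u := (x - 1) ^+ _; set v := x ^+ j in xj *; move=> IH u0.
have j0 : 0 <= j.+1%:R :> R by [].
have x0 : 0 <= x - 1 by lra.
have := ler_wpM2l x0 IH; have := mulr_ge0 j0 xj; lra.
Qed.

(** With [x = n + 1] this closes the induction for the coefficients of [cheb]: the left side is what
    the recurrence produces. *)
Lemma binomial_pow (x : R) j : 1 <= x ->
  2 * j.+1%:R * x ^+ j + (x - 1) ^+ j.+1 <= (x + 1) ^+ j.+1.
Proof.
move=> x1; elim: j => [|j IH]; first by rewrite !expr1 expr0; lra.
have := bernoulli_pow j x1; move: IH.
rewrite (exprS (x + 1) j.+1) (exprS (x - 1) j.+1) (exprS x) -[j.+2%:R]natr1.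
have : 0 <= x ^+ j by rewrite exprn_ge0//; lra.
set u := (x - 1) ^+ _; set v := x ^+ j; set z := (x + 1) ^+ _ => v0 IH B.
have x0 : 0 <= x + 1 by lra.
have := ler_wpM2l x0 IH; lra.
Qed.

Lemma coef_cheb_le n j : `|(cheb n)`_j| * j`!%:R <= n%:R ^+ j.
Proof.
elim/nat_ind2: n j => [||n IH0 IH1] j.
- by rewrite coef1; case: j => [|j]; rewrite ?normr1 ?mulr1 ?expr0// normr0 mul0r expr0n.
- rewrite coefX; case: j => [|[|j]]; rewrite ?normr1 ?normr0 ?mul0r ?expr1n//.
  by rewrite mul1r.
rewrite chebSS coefB coefMn coefXM; case: j => [|j] /=.
  by rewrite mul0rn sub0r normrN (le_trans (IH0 0%N)) ?expr0.
have n1 : 1 <= n.+1%:R :> R by rewrite ler1n.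
have := binomial_pow j n1; rewrite natr1 -{2}[n.+1%:R]natr1 addrK.
apply: le_trans; rewrite factS natrM.
have := IH1 j; have := IH0 j.+1; rewrite factS natrM.
have := ler_normB ((cheb n.+1)`_j *+ 2) (cheb n)`_j.+1; rewrite normrMn mulr2n.
set u := `|_ - _|; set a := `|(cheb n.+1)`_j|; set b := `|(cheb n)`_j.+1|.
set F := j`!%:R; set J := j.+1%:R => h h0 h1.
have F0 : 0 <= F by [].
have J0 : 0 <= J by [].
have := ler_wpM2r (mulr_ge0 J0 F0) h; have := ler_wpM2l J0 h1; lra.
Qed.

(** The part of [p] of parity [b], divided by ['X^b] and read as a polynomial in the square of the
    variable. *)
Definition half_poly (b : bool) p := if b then odd_poly p else even_poly p.

Lemma horner_half_poly (b : bool) p (x : R) :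
  x ^+ b * (half_poly b p).[x ^+ 2] = (p.[x] + (-1) ^+ b * p.[- x]) / 2.
Proof.
have h z : p.[z] = (even_poly p).[z ^+ 2] + (odd_poly p).[z ^+ 2] * z.
  by rewrite -{1}(poly_even_odd p) hornerD hornerM !horner_comp hornerX hornerXn.
by rewrite (h x) (h (- x)) sqrrN /half_poly; case: b => /=; field.
Qed.

Lemma coef_half_poly (b : bool) p i : (half_poly b p)`_i = p`_(i.*2 + b).
Proof. by case: b; rewrite ?coef_odd_poly ?coef_even_poly ?addn1 ?addn0. Qed.

Lemma size_half_poly (b : bool) p m : (size p <= (m.*2 + b).+1)%N ->
  (size (half_poly b p) <= m.+1)%N.
Proof.
rewrite /half_poly; case: b => s.
  by rewrite (leq_trans (size_odd_poly _))//; lia.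
by rewrite (leq_trans (size_even_poly _))//; lia.
Qed.

(* The extremal property of the Chebyshev polynomials at the centre of the
   interval; the parity of [j] decides whether [cheb n] or [cheb n.-1] is
   extremal. *)
Lemma coef_poly_bound n p (A : R) j : (size p <= n)%N ->
  (forall x : R, `|x| <= 1 -> `|p.[x]| <= A) -> `|p`_j| * j`!%:R <= A * n%:R ^+ j.
Proof.
move=> sp pA.
have A0 : 0 <= A by rewrite (le_trans _ (pA 0 _))// normr0 ler01.
have [jn|] := ltnP j n; last first.
  by move=> nj; rewrite nth_default ?(leq_trans sp)// normr0 mul0r mulr_ge0// exprn_ge0.
(* [d] is the one of [n] and [n - 1] that has the parity of [j]; the points [x k] with [k <= m] are
   the extremal points of [cheb d] in [[0, 1]]. *)
pose b := odd j; pose m := (n - b)./2; pose d := (m.*2 + b)%N.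
have dn : (d <= n)%N by rewrite /d /m /b; lia.
have nd : (n <= d.+1)%N by rewrite /d /m /b; lia.
have jE : j = (j./2.*2 + b)%N by rewrite addnC odd_double_half.
pose x k : R := cos (pi / d%:R *+ k).
have xhalf k : (k <= m)%N -> 0 <= (pi : R) / d%:R *+ k <= pi / 2.
  move=> km; rewrite mulrn_wge0 ?divr_ge0 ?pi_ge0//=.
  rewrite -mulr_natr mulrAC -mulrA ler_wpM2l ?pi_ge0//.
  have [->|d0] := posnP d; first by rewrite invr0 mulr0 invr_ge0.
  rewrite ler_pdivrMr ?ltr0n// mulrC ler_pdivlMr//.
  by rewrite -natrM ler_nat /d; lia.
have x0 k : (k <= m)%N -> 0 <= x k.
  move=> km; have /andP[h1 h2] := xhalf k km; apply: cos_ge0_pihalf; rewrite h2 andbT.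
  by rewrite (le_trans _ h1)// oppr_le0 divr_ge0 ?pi_ge0.
have xdec i k : (i < k <= m)%N -> x k < x i.
  move=> /andP[ik km]; have d0 : (0 < d)%N by rewrite /d; lia.
  have p2 : pi / 2 <= pi :> R by rewrite ler_pdivrMr// ler_peMr ?pi_ge0// ler1n.
  rewrite ltr_cos ?in_itv/=.
  - by rewrite ltr_pMn2l ?divr_gt0 ?pi_gt0 ?ltr0n.
  - by have /andP[-> /le_trans ->] := xhalf i (leq_trans (ltnW ik) km).
  - by have /andP[-> /le_trans ->] := xhalf k km.
have chebx k : (k <= m)%N -> (cheb d).[x k] = (-1) ^+ k.
  move=> km; rewrite cheb_cos; have [d0|d0] := posnP d.
    have -> : k = 0%N by move: km d0; rewrite /d; lia.
    by rewrite mulr0n mul0rn cos0.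
  rewrite -mulrnA mulnC mulrnA -[_ / _ *+ d]mulr_natr divfK ?pnatr_eq0 -?lt0n//.
  by rewrite -[pi *+ k]add0r cosDpin cos0 mulr1.
have hb k : (k <= m)%N -> x k ^+ b * (half_poly b (cheb d)).[x k ^+ 2] = (-1) ^+ k.
  move=> km; rewrite horner_half_poly.
  have -> : (cheb d).[- x k] = (-1) ^+ b * (cheb d).[x k].
    rewrite -[- x k]cosDpi !cheb_cos mulrnDl cosDpin.
    by rewrite -signr_odd /d oddD odd_double /b oddb.
  rewrite mulrA -expr2 sqrr_sign mul1r chebx//; by field.
have xb k : (k <= m)%N -> 0 < x k ^+ b.
  move=> km; rewrite lt_neqAle exprn_ge0 ?x0// andbT eq_sym; apply/eqP => xk.
  by have /eqP := hb k km; rewrite xk mul0r eq_sym signr_eq0.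
rewrite jE -coef_half_poly.
(* The halves are compared at the squared nodes with weights [(x k ^+ b)^-1]; [minn k m] keeps the
   weights nonnegative for indices beyond [m]. *)
have E0 := @coef_le_alternating m (fun k => x (minn k m) ^+ 2) (fun k => (x (minn k m) ^+ b)^-1)
  (half_poly b (cheb d)) (half_poly b p) A j./2.
apply: (@le_trans _ _ (A * `|(half_poly b (cheb d))`_j./2| * (j./2.*2 + b)`!%:R)).
  rewrite ler_wpM2r//; apply: E0.
  - by move=> i; exact: sqr_ge0.
  - move=> i k ikm; have /andP[ik km] := ikm.
    have im : (i <= m)%N by rewrite (leq_trans _ km)// ltnW.
    by rewrite (minn_idPl km) (minn_idPl im) ltr_pXn2r// ?nnegrE ?x0// xdec.
  - by move=> k; rewrite invr_ge0 ltW// xb// geq_minr.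
  - exact/size_half_poly/size_cheb.
  - exact/size_half_poly/(leq_trans sp).
  - move=> k km; rewrite (minn_idPl km) -(hb k km) mulrAC mulfV ?mul1r// gt_eqF// xb//.
  - move=> k km; rewrite (minn_idPl km) ler_pdivlMr ?xb// mulrC.
    rewrite -(ger0_norm (ltW (xb k km))) -normrM horner_half_poly.
    have xk : `|x k| <= 1 by exact: cos_max.
    rewrite normrM [`|2^-1|]ger0_norm// ler_pdivrMr// mulr_natr mulr2n.
    rewrite (le_trans (ler_normD _ _))// lerD ?pA//.
    by rewrite normrMsign pA// normrN.
rewrite coef_half_poly -mulrA ler_wpM2l// (le_trans (coef_cheb_le _ _))//.
by rewrite lerXn2r ?nnegrE// ler_nat.
Qed.
End ChebyshevCoefficients.

(** * Interpolation of derivatives on an interval *)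

Section Interpolation1D.
Variable R : realType.
Implicit Types (G : nat -> R -> R) (A B r s : R).

Lemma is_derive_horner (p : {poly R}) s : is_derive s 1 (horner p) (p^`()).[s].
Proof.
have -> : (p^`()).[s] = 'D_1 (horner p) s by rewrite -derive1E -derivE.
exact/derivableP/derivable_horner.
Qed.

Lemma derive_ge0_le (f df : R -> R) r : 0 <= r ->
  (forall s, 0 <= s <= r -> is_derive s 1 f (df s)) ->
  (forall s, 0 <= s <= r -> 0 <= df s) -> f 0 <= f r.
Proof.
move=> r0 fdf df0.
have [||c] := @MVT_segment R f df 0 r r0.
- by move=> x; rewrite in_itv/= => /andP[x0 xr]; apply: fdf; rewrite !ltW.
- apply: derivable_within_continuous => x; rewrite in_itv/= => xr.
  by have := fdf x xr.
rewrite in_itv/= => cr fE; rewrite -subr_ge0 fE subr0 mulr_ge0//.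
exact: df0.
Qed.

(** [G i] plays the role of the [i]-th derivative of [G 0]; the sum stops below order [N], where the
    remainder begins. *)
Definition taylor_poly G N := \poly_(i < N) (G i 0 / i`!%:R).

(** By induction the shifted sequence controls the derivative of the remainder, so the bound plus or
    minus the remainder is nondecreasing and vanishes at 0. *)
Lemma taylor_bound_pos G N r B : 0 <= r ->
  (forall i s, (i < N)%N -> 0 <= s <= r -> is_derive s 1 (G i) (G i.+1 s)) ->
  (forall s, 0 <= s <= r -> `|G N s| <= B) ->
  forall s, 0 <= s <= r -> `|G 0%N s - (taylor_poly G N).[s]| <= B / N`!%:R * s ^+ N.
Proof.
elim: N G => [|N IH] G r0 dG GB s sr.
  by rewrite /taylor_poly poly_def big_ord0 horner0 subr0 expr0 mulr1 divr1 GB.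
have {}IH := IH (fun i => G i.+1) r0 (fun i s iN => dG i.+1 s iN) GB.
have dT : (taylor_poly G N.+1)^`() = taylor_poly (fun i => G i.+1) N.
  apply/polyP => i; rewrite coef_deriv !coef_poly ltnS; case: ifP => _; last first.
    by rewrite mul0rn.
  by rewrite -[LHS]mulr_natr factS natrM [_ * i`!%:R]mulrC invfM mulrA divfK ?pnatr_eq0.
have T0 : (taylor_poly G N.+1).[0] = G 0%N 0.
  by rewrite horner_coef0 coef_poly /= divr1.
pose E s := B / N.+1`!%:R * s ^+ N.+1.
have dE (u : R) : is_derive u 1 E (B / N`!%:R * u ^+ N).
  have -> : E = horner ((B / N.+1`!%:R) *: 'X^(N.+1)).
    by apply/funext => z; rewrite hornerZ hornerXn.
  apply: (@is_derive_eq _ _ _ _ _ _ _ _ (is_derive_horner _ _)).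
  rewrite derivZ derivXn hornerZ hornerMn hornerXn /= -[X in _ * X = _]mulr_natr factS natrM.
  by rewrite [_ * N`!%:R]mulrC invfM [B * _]mulrA [u ^+ N * _]mulrC mulrA divfK ?pnatr_eq0.
have /andP[s0 sler] := sr.
have us u : 0 <= u <= s -> 0 <= u <= r.
  by move=> /andP[-> /le_trans ->].
have dphi (u : R) : 0 <= u <= s -> is_derive u 1 (fun u => G 0%N u - (taylor_poly G N.+1).[u])
    (G 1%N u - (taylor_poly (fun i => G i.+1) N).[u]).
  move=> /us ur; rewrite -dT; have dG0 := dG 0%N u isT ur.
  have dp := is_derive_horner (taylor_poly G N.+1) u.
  exact: (@is_deriveB _ _ _ _ _ _ _ _ _ dG0 dp).
have E0 : E 0 = 0 by rewrite /E expr0n mulr0.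
rewrite ler_norml; apply/andP; split.
  rewrite -subr_ge0 opprK.
  have := @derive_ge0_le (fun u => (G 0%N u - (taylor_poly G N.+1).[u]) + E u)
    (fun u => (G 1%N u - (taylor_poly (fun i => G i.+1) N).[u]) + B / N`!%:R * u ^+ N) s s0.
  rewrite T0 E0 subrr addr0; apply.
    by move=> u ur; apply: is_deriveD; exact: dphi.
  by move=> u /us /IH; rewrite ler_norml -subr_ge0 opprK => /andP[].
rewrite -subr_ge0.
have := @derive_ge0_le (fun u => E u - (G 0%N u - (taylor_poly G N.+1).[u]))
    (fun u => B / N`!%:R * u ^+ N - (G 1%N u - (taylor_poly (fun i => G i.+1) N).[u])) s s0.
rewrite T0 E0 !subrr; apply.
  by move=> u ur; apply: is_deriveB; exact: dphi.
by move=> u /us /IH; rewrite ler_norml subr_ge0 => /andP[].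
Qed.

Lemma taylor_bound G N r B : 0 <= r ->
  (forall i s, (i < N)%N -> `|s| <= r -> is_derive s 1 (G i) (G i.+1 s)) ->
  (forall s, `|s| <= r -> `|G N s| <= B) ->
  forall s, `|s| <= r -> `|G 0%N s - (taylor_poly G N).[s]| <= B / N`!%:R * `|s| ^+ N.
Proof.
move=> r0 dG GB s sr.
have [s0|s0] := leP 0 s.
  rewrite (ger0_norm s0); apply: (@taylor_bound_pos G N r) => //.
  - by move=> i u iN /andP[u0 ur]; apply: dG; rewrite // ger0_norm.
  - by move=> u /andP[u0 ur]; apply: GB; rewrite // ger0_norm.
  - by rewrite s0 -(ger0_norm s0).
(* Reflection reduces negative [s] to the previous case; the signs make [H] again a sequence of
   successive derivatives. *)
pose H i u := (-1) ^+ i * G i (- u).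
have -> : (taylor_poly G N).[s] = (taylor_poly H N).[- s].
  rewrite !horner_poly; apply: eq_bigr => i _; rewrite /H oppr0 (exprNn s i).
  have : (-1) ^+ i * (-1) ^+ i = 1 :> R by rewrite -expr2 sqrr_sign.
  move: ((-1) ^+ i) => e e2; rewrite -[LHS]mul1r -[X in X * _ = _]e2; ring.
have -> : G 0%N s = H 0%N (- s) by rewrite /H opprK mul1r.
rewrite (ltr0_norm s0); apply: (@taylor_bound_pos H N r) => //.
- move=> i u iN /andP[u0 ur].
  have Nu : `|- u| <= r by rewrite normrN ger0_norm.
  have dGi := dG i (- u) iN Nu.
  have -> : H i = (-1) ^+ i *: (G i \o -%R) by apply/funext.
  have -> : H i.+1 u = (-1) ^+ i *: (G i.+1 (- u) * -1).
    by rewrite /H exprSr -[RHS]/(_ * _) [RHS]mulrA mulrAC.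
  by apply: is_deriveZ; apply: is_derive1_comp.
- by move=> u /andP[u0 ur]; rewrite /H normrMsign GB// normrN ger0_norm.
- by rewrite oppr_ge0 ltW//= -(ltr0_norm s0).
Qed.

(** The last hypothesis keeps the Taylor remainder below [A], so the Taylor polynomial is bounded by
    [2 * A] and [coef_poly_bound] applies to its coefficients. *)
Lemma derivatives_at_center G N j r A B : 0 < r -> (j <= N)%N ->
  (forall i s, (i < N)%N -> `|s| <= r -> is_derive s 1 (G i) (G i.+1 s)) ->
  (forall s, `|s| <= r -> `|G 0%N s| <= A) ->
  (forall s, `|s| <= r -> `|G N s| <= B) ->
  B * r ^+ N <= A * N`!%:R ->
  `|G j 0| <= 2 * A * (N%:R / r) ^+ j.
Proof.
move=> r0 jN dG GA GB BA.
have n0 : `|0 : R| <= r by rewrite normr0 ltW.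
have A0 : 0 <= A by rewrite (le_trans _ (GA 0 n0)).
have Nf0 : 0 < N`!%:R :> R by rewrite ltr0n fact_gt0.
rewrite expr_div_n mulrA ler_pdivlMr ?exprn_gt0//.
(* For [j = N] the bound on [G N] suffices, since N! <= N^N. *)
move: jN; rewrite leq_eqVlt => /orP[/eqP ->|jN].
  apply: le_trans (ler_wpM2r _ (GB 0 n0)) _; first by rewrite exprn_ge0// ltW.
  apply: le_trans BA _; rewrite [2 * A]mulrC -mulrA ler_wpM2l// -natrX -natrM ler_nat.
  rewrite (leq_trans _ (leq_pmull _ _))//; elim: (N) => // n IH.
  rewrite factS expnS leq_mul// (leq_trans IH)//.
  by case: (posnP n) => [->//|?]; rewrite leq_exp2r.
(* The Taylor polynomial rescaled from [[-r, r]] to [[-1, 1]]. *)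
pose P := \poly_(i < N) (G i 0 / i`!%:R * r ^+ i).
have := @coef_poly_bound R N P (2 * A) j (size_poly _ _).
rewrite coef_poly jN normrM normrM normfV [`|j`!%:R|]ger0_norm//.
rewrite [`|r ^+ j|]ger0_norm ?exprn_ge0 ?(ltW r0)// mulrAC divfK ?pnatr_eq0 -?lt0n ?fact_gt0//.
apply => x x1.
have xr : `|r * x| <= r by rewrite normrM (gtr0_norm r0) ger_pMr.
have -> : P.[x] = (taylor_poly G N).[r * x].
  by rewrite !horner_poly; apply: eq_bigr => i _; rewrite exprMn mulrA.
have B0 : 0 <= B by rewrite (le_trans _ (GB 0 n0)).
have := taylor_bound (ltW r0) dG GB xr.
have := GA _ xr; move: (G 0%N _) (_.[_]) => u v uA uv.
have : B / N`!%:R * `|r * x| ^+ N <= A.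
  rewrite mulrAC ler_pdivrMr// (le_trans _ BA)// ler_wpM2l//.
  by apply: lerXn2r; rewrite ?nnegrE ?(ltW r0).
move: uv; rewrite distrC => uv h.
by have := ler_normD (v - u) u; rewrite subrK; lra.
Qed.
End Interpolation1D.

(** * Directional derivatives *)

Section DirectionalDerivatives.
Variables (R : realType) (V : normedModType R).
Implicit Types (f : V -> R) (x y v w : V) (U : set V).

Lemma is_derive_line f x v (s : R) : derivable f (x + s *: v) v ->
  is_derive s 1 (fun s => f (x + s *: v)) ('D_v f (x + s *: v)).
Proof.
have E : (fun h : R => h^-1 *: (((fun s => f (x + s *: v)) \o shift s) (h *: 1)
            - f (x + s *: v))) =
         (fun h => h^-1 *: ((f \o shift (x + s *: v)) (h *: v) - f (x + s *: v))).
  apply/funext => h /=; congr (_ *: (f _ - _)).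
  by rewrite [h *: 1]mulr1 scalerDl addrCA.
by move=> d; split; rewrite /derivable /derive E.
Qed.

Lemma is_derive_scaled_line f x v (h s : R) : derivable f (x + (s * h) *: v) v ->
  is_derive s 1 (fun s => f (x + (s * h) *: v)) (h * 'D_v f (x + (s * h) *: v)).
Proof.
move=> d; rewrite mulrC.
apply: (@is_derive1_comp _ (fun s => f (x + s *: v)) (fun s => s * h)).
  exact: is_derive_line.
have := is_derive_horner (h *: 'X) s; rewrite derivZ derivX hornerZ hornerC mulr1.
by congr is_derive; apply/funext => u; rewrite hornerZ hornerX mulrC.
Qed.

Lemma mean_value_line (F dF : R -> R) : (forall s : R, 0 <= s <= 1 -> is_derive s 1 F (dF s)) ->
  exists2 c : R, 0 <= c <= 1 & F 1 - F 0 = dF c.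
Proof.
move=> d; have [||c] := @MVT_segment R F dF 0 1 ler01.
- by move=> s; rewrite in_itv/= => /andP[s0 s1]; apply: d; rewrite !ltW.
- apply: derivable_within_continuous => s; rewrite in_itv/= => sr.
  by have := d s sr.
by rewrite in_itv/= => c01 ->; exists c; rewrite // subr0 mulr1.
Qed.

Lemma mean_value_dir f x v (h : R) :
  (forall s : R, 0 <= s <= 1 -> derivable f (x + (s * h) *: v) v) ->
  exists2 c : R, 0 <= c <= 1 & f (x + h *: v) - f x = h * 'D_v f (x + (c * h) *: v).
Proof.
move=> d; have [s s01|c c01] := @mean_value_line (fun s => f (x + (s * h) *: v))
  (fun s => h * 'D_v f (x + (s * h) *: v)); first exact/is_derive_scaled_line/d.
by rewrite mul1r mul0r scale0r addr0; exists c.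
Qed.

Lemma is_derive_scaled_dir f x v (c : R) : derivable f x v ->
  is_derive x (c *: v) f (c * 'D_v f x).
Proof.
have [->|c0] := eqVneq c 0; first by rewrite scale0r mul0r => _; exact: is_derive0.
move=> d; have d' : derivable f (x + (0 * c) *: v) v by rewrite mul0r scale0r addr0.
have := is_derive_scaled_line d'; rewrite mul0r scale0r addr0.
have E : (fun h : R => h^-1 *: (((fun s => f (x + (s * c) *: v)) \o shift 0) (h *: 1)
            - f (x + (0 * c) *: v))) =
         (fun h => h^-1 *: ((f \o shift x) (h *: (c *: v)) - f x)).
  apply/funext => h /=; rewrite mul0r scale0r !addr0.
  by rewrite [h *: 1]mulr1 scalerA [x + _]addrC.
by case; rewrite /derivable /derive E => d1 d2; split.
Qed.

(** The mean value theorem is used along [v] for the difference of [f] on two parallel sides, then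
    along [w]. *)
Lemma second_difference f x v w (h : R) :
  (forall a b : R, 0 <= a <= 1 -> 0 <= b <= 1 ->
     let y := x + (a * h) *: v + (b * h) *: w in
     derivable f y v /\ derivable ('D_v f) y w) ->
  exists a b : R, [/\ 0 <= a <= 1, 0 <= b <= 1 &
    f (x + h *: v + h *: w) - f (x + h *: w) - (f (x + h *: v) - f x) =
    h * (h * 'D_w ('D_v f) (x + (a * h) *: v + (b * h) *: w))].
Proof.
move=> d.
have i0 : 0 <= (0 : R) <= 1 by rewrite lexx ler01.
have i1 : 0 <= (1 : R) <= 1 by rewrite lexx ler01.
have [s s01|a a01 E] := @mean_value_line
  (fun s => f (x + h *: w + (s * h) *: v) - f (x + (s * h) *: v))
  (fun s => h * 'D_v f (x + h *: w + (s * h) *: v) - h * 'D_v f (x + (s * h) *: v)).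
  have [d1 _] := d s 1 s01 i1; have [d0 _] := d s 0 s01 i0.
  rewrite mul1r addrAC in d1; rewrite mul0r scale0r addr0 in d0.
  exact: (@is_deriveB _ _ _ _ _ _ _ _ _ (is_derive_scaled_line d1) (is_derive_scaled_line d0)).
have [b b01|b b01 E'] := @mean_value_dir ('D_v f) (x + (a * h) *: v) w h.
  by have [] := d a b a01 b01.
exists a, b; split=> //; rewrite -E' mulrBr [x + (a * h) *: v + h *: w]addrAC.
move: E; rewrite !mul1r !mul0r !scale0r !addr0 => <-.
by rewrite [x + h *: v + h *: w]addrAC; lra.
Qed.

Lemma near_equal_values (h e z1 z2 a1 a2 D : R) : 0 < h ->
  `|z1 - a1| < e / 2 -> `|z2 - a2| < e / 2 ->
  D = h * (h * a1) -> D = h * (h * a2) -> `|z1 - z2| <= e.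
Proof.
move=> h0 k1 k2 -> /(mulfI (lt0r_neq0 h0)) /(mulfI (lt0r_neq0 h0)) E.
by apply: le_trans (ler_distD a1 _ _) _; move: k1 k2; rewrite E [`|z2 - _|]distrC; lra.
Qed.

(** Schwarz's theorem. The second difference is symmetric in [v] and [w] and equals [h ^+ 2] times
    either mixed derivative at points near [x]; continuity at [x] concludes. *)
Lemma derive_comm f U x v w : open U -> U x ->
  (forall y u, U y -> derivable f y u) ->
  (forall y u u', U y -> derivable ('D_u f) y u') ->
  {for x, continuous ('D_w ('D_v f))} -> {for x, continuous ('D_v ('D_w f))} ->
  'D_w ('D_v f) x = 'D_v ('D_w f) x.
Proof.
move=> oU Ux d1 d2 c1 c2; apply/eqP; rewrite -subr_eq0 -normr_le0.
apply/ler_addgt0Pr => e e0; rewrite add0r.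
have e2 : 0 < e / 2 by rewrite divr_gt0.
have : \forall y \near x, [/\ U y, `|'D_w ('D_v f) x - 'D_w ('D_v f) y| < e / 2 &
                              `|'D_v ('D_w f) x - 'D_v ('D_w f) y| < e / 2].
  have n0 : nbhs x U by exact: open_nbhs_nbhs.
  have /cvgrPdist_lt n1 := c1; have /cvgrPdist_lt n2 := c2.
  apply: filterS3 n0 (n1 _ e2) (n2 _ e2) => y h0 h1 h2.
  by split; [exact: h0 | exact: h1 | exact: h2].
move=> /nbhs_ballP[r /= r0 rP].
(* This choice of [q] and [h] keeps the parallelogram spanned by [h *: v] and [h *: w] inside the
   ball of radius [r]. *)
pose q := 1 + `|v| + `|w|; have q0 : 0 < q by rewrite /q ltr_wpDr// ltr_wpDr.
have [h h0 hE] : exists2 h, 0 < h & r = h * q.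
  by exists (r / q); rewrite ?divr_gt0// divfK// gt_eqF.
have near_x (v' w' : V) (a b : R) : `|v'| + `|w'| < q ->
    0 <= a <= 1 -> 0 <= b <= 1 -> ball x r (x + (a * h) *: v' + (b * h) *: w').
  move=> q' /andP[a0 a1] /andP[b0 b1]; rewrite -ball_normE /= -addrA opprD addNKr normrN.
  rewrite hE; apply: le_lt_trans (ler_normD _ _) _; rewrite !(normrZ, normrM).
  rewrite !(ger0_norm a0) !(ger0_norm b0) !(gtr0_norm h0).
  have := ler_wpM2r (mulr_ge0 (ltW h0) (normr_ge0 v')) a1.
  have := ler_wpM2r (mulr_ge0 (ltW h0) (normr_ge0 w')) b1.
  by move: q'; rewrite -(ltr_pM2l h0); lra.
have qvw : `|v| + `|w| < q by rewrite /q; lra.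
have qwv : `|w| + `|v| < q by rewrite /q; lra.
have [a b a01 b01 y|a [b [a01 b01 E1]]] := @second_difference f x v w h.
  by have [Uy _ _] := rP _ (near_x v w a b qvw a01 b01); split; [exact: d1|exact: d2].
have [a' b' a01' b01' y|a' [b' [a01' b01' E2]]] := @second_difference f x w v h.
  by have [Uy _ _] := rP _ (near_x w v a' b' qwv a01' b01'); split; [exact: d1|exact: d2].
have [_ k1 _] := rP _ (near_x v w a b qvw a01 b01).
have [_ _ k2] := rP _ (near_x w v a' b' qwv a01' b01').
have {}E2 : f (x + h *: v + h *: w) - f (x + h *: w) - (f (x + h *: v) - f x) =
    h * (h * 'D_v ('D_w f) (x + (a' * h) *: w + (b' * h) *: v)).
  by apply: etrans E2; rewrite [x + h *: w + h *: v]addrAC; ring.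
exact: (near_equal_values h0 k1 k2 E1 E2).
Qed.

(** The increment along [v + w] is split at [x + h *: v]; the mean value theorem turns the second
    part into a value of ['D_w f] near [x], whence the continuity hypothesis. *)
Lemma derive_addv f U x v w : open U -> U x ->
  (forall y u, U y -> derivable f y u) -> {for x, continuous ('D_w f)} ->
  'D_(v + w) f x = 'D_v f x + 'D_w f x.
Proof.
move=> oU Ux d cw; apply: cvg_lim => //.
have -> : (fun h : R => h^-1 *: ((f \o shift x) (h *: (v + w)) - f x)) =
  (fun h => h^-1 *: ((f \o shift x) (h *: v) - f x)) \+
  (fun h => h^-1 *: (f (x + h *: v + h *: w) - f (x + h *: v))).
  apply/funext => h /=; rewrite -scalerDr; congr (_ *: _).
  by rewrite scalerDr [h *: v + x]addrC [_ + x]addrC addrA; ring.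
apply: cvgD; first exact: d.
apply/cvgrPdist_lt => e e0.
have : \forall y \near x, U y /\ `|'D_w f x - 'D_w f y| < e.
  have n0 : nbhs x U by exact: open_nbhs_nbhs.
  have /cvgrPdist_lt n1 := cw.
  by apply: filterS2 n0 (n1 _ e0) => y.
move=> /nbhs_ballP[r /= r0 rP].
pose q := 1 + `|v| + `|w|; have q0 : 0 < q by rewrite /q ltr_wpDr// ltr_wpDr.
have rq0 : 0 < r / q by rewrite divr_gt0.
near=> h.
have h0 : h != 0 by near: h; exact: nbhs_dnbhs_neq.
have hr : `|h| < r / q by near: h; exact: dnbhs0_lt.
have near_x (a : R) : 0 <= a <= 1 -> ball x r (x + h *: v + (a * h) *: w).
  move=> /andP[a0 a1]; rewrite -ball_normE /= -addrA opprD addNKr normrN.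
  apply: le_lt_trans (ler_normD _ _) _; rewrite !(normrZ, normrM) (ger0_norm a0).
  move: hr; rewrite ltr_pdivlMr// => hr; apply: le_lt_trans hr.
  have := ler_wpM2r (mulr_ge0 (normr_ge0 h) (normr_ge0 w)) a1.
  by rewrite /q; have := normr_ge0 h; nra.
have [s s01|c c01 ->] := @mean_value_dir f (x + h *: v) w h.
  by have [Uy _] := rP _ (near_x s s01); exact: d.
rewrite [_ *: _]mulrA mulVf// mul1r.
by have [_] := rP _ (near_x c c01).
Unshelve. all: by end_near. Qed.

Lemma derive_sumv f U x (I : Type) (s : seq I) (c : I -> R) (e : I -> V) :
  open U -> U x -> (forall y u, U y -> derivable f y u) ->
  (forall w, {for x, continuous ('D_w f)}) ->
  'D_(\sum_(i <- s) c i *: e i) f x = \sum_(i <- s) c i * 'D_(e i) f x.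
Proof.
move=> oU Ux d cw; elim: s => [|i s IH]; first by rewrite !big_nil derive0.
rewrite !big_cons (derive_addv _ oU)// IH; congr (_ + _).
by have [] := is_derive_scaled_dir (c i) (d x (e i) Ux).
Qed.
End DirectionalDerivatives.

(** * Symmetry of iterated derivatives and reduction to coordinate directions *)

Section SmoothFunctions.
Variables (R : realType) (n : nat) (U : set 'rV[R]_n).
Hypothesis oU : open U.
Local Notation V := 'rV[R]_n.
Implicit Types (f g : V -> R) (x v w : V) (vs ws : seq V).

Lemma iderive_cat f vs ws : iderive f (vs ++ ws) = iderive (iderive f ws) vs.
Proof. by elim: vs => //= v vs ->. Qed.

Lemma smooth_on_iderive f vs : smooth_on U f -> smooth_on U (iderive f vs).
Proof. by move=> sf ws; rewrite -iderive_cat; exact: sf. Qed.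

Lemma smooth_on_derivable f x v : smooth_on U f -> U x -> derivable f x v.
Proof. by move=> sf; have [_] := sf [::]; apply. Qed.

Lemma smooth_on_continuous f x : smooth_on U f -> U x -> {for x, continuous f}.
Proof. by move=> sf Ux; have [+ _] := sf [::]; apply; rewrite inE. Qed.

(** As [U] is open, equality on [U] is equality near each of its points and passes to
    derivatives. *)
Lemma iderive_eq_on f g vs : {in U, f =1 g} -> {in U, iderive f vs =1 iderive g vs}.
Proof.
move=> fg; elim: vs => //= v vs IH x; rewrite inE => Ux.
apply: near_eq_derive; near=> y; apply: IH; rewrite inE; near: y.
exact: open_nbhs_nbhs.
Unshelve. all: by end_near. Qed.

Lemma eq_on_continuous f g x : {in U, f =1 g} -> U x ->
  {for x, continuous f} -> {for x, continuous g}.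
Proof.
move=> fg Ux cf; have fgx : f x = g x by apply: fg; rewrite inE.
change (g @ x --> g x); rewrite -fgx; apply: cvg_trans cf.
apply: (@near_eq_cvg _ _ (nbhs x)).
have : nbhs x U by exact: open_nbhs_nbhs.
by apply: filterS => y Uy; apply: fg; rewrite inE.
Qed.

Lemma eq_on_derivable f g x v : {in U, f =1 g} -> U x -> derivable f x v -> derivable g x v.
Proof.
move=> fg Ux; apply: near_eq_derivable; near=> y; apply/fg; rewrite inE; near: y.
exact: open_nbhs_nbhs.
Unshelve. all: by end_near. Qed.

Lemma derive_comm_smooth f x v w : smooth_on U f -> U x ->
  'D_v ('D_w f) x = 'D_w ('D_v f) x.
Proof.
move=> sf Ux; apply: (@derive_comm _ _ f U) => //.
- by move=> y u; exact: smooth_on_derivable.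
- by move=> y u u'; apply: smooth_on_derivable; exact: (@smooth_on_iderive f [:: u]).
- exact: (smooth_on_continuous (smooth_on_iderive [:: v; w] sf) Ux).
- exact: (smooth_on_continuous (smooth_on_iderive [:: w; v] sf) Ux).
Qed.

Lemma iderive_move f vs v ws : smooth_on U f ->
  {in U, iderive f (vs ++ v :: ws) =1 iderive f (v :: vs ++ ws)}.
Proof.
move=> sf; elim: vs => // w vs IH x; rewrite inE => Ux /=.
apply: etrans (@derive_comm_smooth (iderive f (vs ++ ws)) x w v _ Ux).
  by apply: (iderive_eq_on [:: w] IH); rewrite inE.
exact: smooth_on_iderive.
Qed.

Lemma iderive_perm f vs ws : smooth_on U f -> perm_eq vs ws ->
  {in U, iderive f vs =1 iderive f ws}.
Proof.
move=> sf; elim: vs ws => [|v vs IH] ws.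
  by rewrite perm_sym => /perm_nilP -> x _.
move=> p; have vws : v \in ws by rewrite -(perm_mem p) mem_head.
move: p; case/path.splitPr: vws => a b p.
have {}p : perm_eq vs (a ++ b) by rewrite -(perm_cons v) (perm_trans p)// -[v :: b]cat1s perm_catCA.
move=> x Ux; rewrite iderive_move//.
exact: (iderive_eq_on [:: v] (IH _ p) Ux).
Qed.

Lemma derive_coord f x v : smooth_on U f -> U x ->
  'D_v f x = \sum_(i < n) v ord0 i * 'D_(delta_mx 0 i) f x.
Proof.
move=> sf Ux; rewrite {1}[v]row_sum_delta (derive_sumv _ _ _ oU)//.
- by move=> y u; exact: smooth_on_derivable.
- by move=> w; exact: (smooth_on_continuous (smooth_on_iderive [:: w] sf) Ux).
Qed.

Lemma ler_coord_eucl_norm v i : `|v ord0 i| <= eucl_norm v.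
Proof.
rewrite -sqrtr_sqr; apply: ler_wsqrtr; rewrite (bigD1 i)//= lerDl.
by apply: sumr_ge0 => j _; exact: sqr_ge0.
Qed.

Lemma eucl_norm_delta (i : 'I_n) : eucl_norm (delta_mx 0 i : V) = 1.
Proof.
rewrite /eucl_norm (bigD1 i)//= mxE !eqxx expr1n big1 ?addr0 ?sqrtr1// => j ji.
by rewrite mxE (negbTE ji) andbF expr0n.
Qed.

Definition coord_vecs : seq V := [seq delta_mx 0 i | i <- enum 'I_n].

(** The outermost direction is expanded in coordinates, each at most 1 in absolute value, and moved
    innermost so that the induction hypothesis applies to ['D_(delta_mx 0 i) f]. Each direction
    costs [n] terms. *)
Lemma iderive_coord_bound f x vs (B : R) : smooth_on U f -> U x -> unit_vecs vs ->
  (forall ws, size ws = size vs -> {subset ws <= coord_vecs} -> `|iderive f ws x| <= B) ->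
  `|iderive f vs x| <= n%:R ^+ size vs * B.
Proof.
move=> + Ux; elim: vs f => [|v vs IH] f sf uv fB /=.
  by rewrite expr0 mul1r; apply: (fB [::]).
rewrite derive_coord//; last exact: smooth_on_iderive.
apply: (@le_trans _ _ (\sum_(i < n) (n%:R ^+ size vs * B))); last first.
  by rewrite sumr_const card_ord -[leLHS]mulr_natl exprS mulrA.
apply: le_trans (ler_norm_sum _ _ _) _; apply: ler_sum => i _; rewrite normrM.
rewrite -[leRHS]mul1r ler_pM//.
  by rewrite (le_trans (ler_coord_eucl_norm _ _))// uv// mem_head.
have -> : 'D_(delta_mx 0 i) (iderive f vs) x = iderive ('D_(delta_mx 0 i) f) vs x.
  rewrite -[RHS]/(iderive (iderive f [:: _]) vs x) -iderive_cat iderive_move ?inE//.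
  by rewrite cats0.
apply: IH; first exact: (@smooth_on_iderive f [:: _]).
  by move=> u uvs; apply: uv; rewrite inE uvs orbT.
move=> ws sws sub; rewrite -[iderive _ _]/(iderive (iderive f [:: _]) ws) -iderive_cat.
apply: fB; first by rewrite size_cat sws addn1.
move=> u; rewrite mem_cat => /orP[/sub//|]; rewrite inE => /eqP ->.
by apply/mapP; exists i; rewrite ?mem_enum.
Qed.
End SmoothFunctions.

(** * Intermediate derivatives *)

Section IntermediateDerivatives.
Variable R : realType.
Local Notation e := (expR 1 : R).

(** The induction step comes down to (1 + 1/N)^N <= e. *)
Lemma exprnn_le_fact N : N%:R ^+ N <= e ^+ N * N`!%:R.
Proof.
elim: N => [|N IH]; first by rewrite !expr0 mulr1.
rewrite exprS exprS factS natrM.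
suff : N.+1%:R ^+ N <= e * N%:R ^+ N.
  move=> h; have h' := le_trans h (ler_wpM2l (expR_ge0 1) IH).
  by have := ler_wpM2l (ler0n R N.+1) h'; rewrite mulrACA mulrCA !mulrA; lra.
case: (posnP N) => [->|N0]; first by rewrite !expr0 mulr1 -expR0 ler_expR.
have N0' : 0 < N%:R :> R by rewrite ltr0n.
have := expR_ge1Dx (N%:R^-1 : R) => h1.
have : (1 + N%:R^-1) ^+ N <= expR (N%:R^-1 : R) ^+ N.
  by apply: lerXn2r; rewrite ?nnegrE ?expR_ge0// addr_ge0// invr_ge0.
rewrite -expRM_natl mulfV ?gt_eqF// -(ler_pM2r (exprn_gt0 N N0')) -exprMn.
by rewrite mulrDl mul1r mulVf ?gt_eqF// natr1.
Qed.

(** The half-length r = N / (e tau) is chosen such that (tau r)^N = (N / e)^N <= N! and N / r = e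
    tau. *)
Lemma derivatives_at_center_scaled (G : nat -> R -> R) N j (A tau : R) : 0 < tau -> (j <= N)%N ->
  (forall i (s : R), (i < N)%N -> `|s| <= N%:R / (e * tau) -> is_derive s 1 (G i) (G i.+1 s)) ->
  (forall s : R, `|s| <= N%:R / (e * tau) -> `|G 0%N s| <= A) ->
  (forall s : R, `|s| <= N%:R / (e * tau) -> `|G N s| <= A * tau ^+ N) ->
  `|G j 0| <= 2 * A * (e * tau) ^+ j.
Proof.
move=> tau0 jN dG GA GB.
have et0 : 0 < e * tau by rewrite mulr_gt0 ?expR_gt0.
have A0 : 0 <= A by rewrite (le_trans _ (GA 0 _))// normr0 divr_ge0// ltW.
(* For [N = 0] the interval degenerates to a point. *)
case: (posnP N) jN => [N0|N0 jN].
  rewrite N0 leqn0 => /eqP ->; rewrite expr0 mulr1.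
  by rewrite (le_trans (GA 0 _)) ?ler_peMl ?ler1n// normr0 divr_ge0// ltW.
have r0 : 0 < N%:R / (e * tau) by rewrite divr_gt0 ?ltr0n.
have -> : e * tau = N%:R / (N%:R / (e * tau)).
  by rewrite invf_div mulrCA mulfV ?mulr1// pnatr_eq0 -lt0n.
apply: (derivatives_at_center r0 jN dG GA GB).
rewrite -mulrA ler_wpM2l// -exprMn mulrCA invfM [e^-1 * _]mulrC [tau * _]mulrA.
rewrite mulfV ?gt_eqF// mul1r.
by rewrite expr_div_n ler_pdivrMr ?exprn_gt0 ?expR_gt0// mulrC exprnn_le_fact.
Qed.

Section Multidimensional.
Variables (n : nat) (U : set 'rV[R]_n).
Hypothesis oU : open U.
Local Notation V := 'rV[R]_n.

Lemma iderive_nseq_line (g : V -> R) (x v : V) i (s : R) :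
  smooth_on U g -> U (x + s *: v) ->
  is_derive s 1 (fun s => iderive g (nseq i v) (x + s *: v))
                (iderive g (nseq i.+1 v) (x + s *: v)).
Proof.
move=> sg Us; apply: is_derive_line; apply: (@smooth_on_derivable _ _ U) Us.
exact: smooth_on_iderive.
Qed.

(* The directions in [L] are treated one after the other, each of them
   costing [N / (e * tau)] of the radius. *)
Lemma iderive_interpolation (L0 L : seq V) (g : V -> R) (A tau : R) N vs x :
  smooth_on U g -> 0 <= A -> 0 < tau ->
  (forall v, v \in L0 -> `|v| <= 1) -> {subset L <= L0} ->
  (size vs <= N)%N -> {subset vs <= L} ->
  (forall y, `|x - y| <= (size L)%:R * (N%:R / (e * tau)) ->
     [/\ U y, `|g y| <= A &
      forall ws, size ws = N -> {subset ws <= L0} -> `|iderive g ws y| <= A * tau ^+ N]) ->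
  `|iderive g vs x| <= 2 ^+ size L * A * (e * tau) ^+ size vs.
Proof.
move=> sg A0 tau0 L01.
have et0 : 0 < e * tau by rewrite mulr_gt0 ?expR_gt0.
set r := N%:R / (e * tau); have r0 : 0 <= r by rewrite divr_ge0// ltW.
elim: L vs x => [|v L IH] vs x sL sN sub hx.
  have -> : vs = [::].
    by case: vs sub {sN} => // v vs /(_ v); rewrite mem_head => /(_ isT).
  by rewrite mul0r /= in hx; have [|_ + _] := hx x; rewrite ?subrr ?normr0// !expr0 mulr1 mul1r.
pose rest := [seq w <- vs | w != v]; pose a := count_mem v vs.
have pvs : perm_eq vs (nseq a v ++ rest).
  have -> : nseq a v = [seq w <- vs | w == v].
    by rewrite (all_pred1P v _ (filter_all _ _)) size_filter.
  by rewrite perm_sym (perm_filterC (pred1 v) vs).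
have sz : (size rest + a)%N = size vs.
  by rewrite (perm_size pvs) size_cat size_nseq addnC.
have vL0 : v \in L0 by apply: sL; rewrite mem_head.
have sL' : {subset L <= L0} by move=> w wL; apply: sL; rewrite inE wL orbT.
have Ux : U x.
  by have [] := hx x; rewrite // subrr normr0 mulr_ge0.
(* Interpolation along [v] is applied to [iderive g rest]: order 0 is bounded by induction, order
   [N - b] by the hypothesis on total order [N], the factors of [A'] other than [A] and [tau ^+ b]
   being at least 1. *)
pose b := size rest; pose A' := 2 ^+ size L * A * (e * tau) ^+ b.
have bN : (b <= N)%N by rewrite (leq_trans _ sN)// -sz leq_addr.
have g' y : `|x - y| <= r -> [/\ U y, `|iderive g rest y| <= A' &
    `|iderive g (nseq (N - b) v ++ rest) y| <= A' * tau ^+ (N - b)].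
  move=> xy.
  have hy z : `|y - z| <= (size L)%:R * r -> `|x - z| <= (size (v :: L))%:R * r.
    move=> yz; apply: le_trans (ler_distD y _ _) _.
    by rewrite /= -natr1 mulrDl mul1r addrC lerD.
  have [Uy _ gN] : [/\ U y, `|g y| <= A & forall ws, size ws = N ->
      {subset ws <= L0} -> `|iderive g ws y| <= A * tau ^+ N].
    by apply: hx; apply: hy; rewrite subrr normr0 mulr_ge0.
  split=> //.
    apply: IH => //.
    - move=> w; rewrite mem_filter => /andP[wv /sub]; rewrite inE (negbTE wv).
      by [].
    - by move=> z /hy /hx.
  have restL0 : {subset rest <= L0}.
    by move=> w; rewrite mem_filter => /andP[_ /sub /sL].
  apply: le_trans (gN _ _ _) _.
  - by rewrite size_cat size_nseq subnK.
  - by move=> w; rewrite mem_cat => /orP[|/restL0//]; rewrite mem_nseq => /andP[_ /eqP ->].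
  rewrite /A' exprMn -!mulrA -{1}(subnK bN) addnC exprD !mulrA.
  rewrite !ler_wpM2r ?exprn_ge0 ?(ltW tau0)//.
  rewrite -[leLHS]mul1r mulrAC ler_wpM2r//.
  rewrite -[leLHS]mulr1 ler_pM ?exprn_ege1 ?ler1n//.
  by rewrite -expR0 ler_expR.
have -> : iderive g vs x = iderive (iderive g rest) (nseq a v) (x + 0 *: v).
  by rewrite scale0r addr0 -iderive_cat; apply: (iderive_perm oU sg pvs); rewrite inE.
have sv (s : R) : `|s| <= (N - b)%:R / (e * tau) -> `|x - (x + s *: v)| <= r.
  move=> sr; rewrite opprD addNKr normrN normrZ.
  rewrite -[leRHS]mulr1 ler_pM// ?L01// (le_trans sr)//.
  by rewrite ler_wpM2r ?invr_ge0 ?(ltW et0)// ler_nat leq_subr.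
have -> : 2 ^+ size (v :: L) * A * (e * tau) ^+ size vs = 2 * A' * (e * tau) ^+ a.
  by rewrite /A' -sz exprD /= exprS -/b; ring.
apply: (@derivatives_at_center_scaled
  (fun i s => iderive (iderive g rest) (nseq i v) (x + s *: v)) (N - b)) => //.
- by rewrite leq_subRL// sz.
- move=> i s iN /sv /g' [Us _ _]; apply: iderive_nseq_line => //.
  exact: smooth_on_iderive.
- by move=> s /sv /g' [].
- by move=> s /sv /g' [_ _]; rewrite iderive_cat.
Qed.
End Multidimensional.
End IntermediateDerivatives.

(** * The regularized sequence *)

Section Regularization.
Variables (R : realType) (M : nat -> R).
Hypothesis M0 : forall k, 0 < M k.
Local Notation e := (expR 1 : R).
Let m k : R := k`!%:R * M k.
Let mbc k : R := k`!%:R * Mbc M k.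

(** This says that (k! M_k)^(1/k) tends to infinity; it makes the supremum in [TM] finite. *)
Hypothesis m_superexp : forall D : R, 0 < D -> exists2 c, 0 < c & forall k, c * D ^+ k <= m k.

Let m0 k : 0 < m k. Proof. by rewrite mulr_gt0// ltr0n fact_gt0. Qed.

Lemma has_sup_TM (t : R) : 0 < t ->
  has_sup (range (fun k : nat => t ^+ k / (k`!%:R * M k))).
Proof.
move=> t0; split; first by exists (t ^+ 0 / (0`!%:R * M 0)); exists 0%N.
have [c c0 cm] := m_superexp t0; exists c^-1 => _ [k _ <-].
by rewrite -/(m k) ler_pdivrMr// ler_pdivlMl.
Qed.

Lemma TM_ge (t : R) k : 0 < t -> t ^+ k / m k <= TM M t.
Proof. by move=> t0; apply: sup_upper_bound; [exact: has_sup_TM | exists k]. Qed.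

Lemma TM_gt0 (t : R) : 0 < t -> 0 < TM M t.
Proof. by move=> t0; apply: lt_le_trans (TM_ge 0 t0); rewrite divr_gt0. Qed.

Lemma TM_le (t b : R) : (forall k, t ^+ k / m k <= b) -> TM M t <= b.
Proof.
move=> tb; apply: ge_sup; first by exists (t ^+ 0 / m 0); exists 0%N.
by move=> _ [k _ <-].
Qed.

Lemma fact_MbcE k : mbc k = sup [set t ^+ k / TM M t | t in [set t : R | 0 < t]].
Proof. by rewrite /mbc mulrA mulfV ?mul1r// pnatr_eq0 -lt0n fact_gt0. Qed.

Lemma has_sup_Mbc k : has_sup [set t ^+ k / TM M t | t in [set t : R | 0 < t]].
Proof.
split; first by exists (1 ^+ k / TM M 1); exists 1 => //=.
exists (m k) => _ [t /= t0 <-]; rewrite ler_pdivrMr ?TM_gt0// mulrC.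
by rewrite -ler_pdivrMr// TM_ge.
Qed.

Lemma fact_Mbc_ge (t : R) k : 0 < t -> t ^+ k / TM M t <= mbc k.
Proof.
by move=> t0; rewrite fact_MbcE; apply: sup_upper_bound; [exact: has_sup_Mbc | exists t].
Qed.

Lemma fact_Mbc_le (b : R) k : (forall t, 0 < t -> t ^+ k / TM M t <= b) -> mbc k <= b.
Proof.
move=> tb; rewrite fact_MbcE; apply: ge_sup; first by have [] := has_sup_Mbc k.
by move=> _ [t /= t0 <-]; exact: tb.
Qed.

Lemma fact_Mbc_gt0 k : 0 < mbc k.
Proof.
by apply: lt_le_trans (@fact_Mbc_ge 1 k ltr01); rewrite divr_gt0 ?TM_gt0// exprn_gt0.
Qed.

Lemma Mbc_gt0 k : 0 < Mbc M k.
Proof. by have := fact_Mbc_gt0 k; rewrite /mbc pmulr_rgt0// ltr0n fact_gt0. Qed.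

Lemma Mbc_le k : Mbc M k <= M k.
Proof.
have : mbc k <= m k; last by rewrite ler_pM2l// ltr0n fact_gt0.
apply: fact_Mbc_le => t t0; rewrite ler_pdivrMr ?TM_gt0// mulrC.
by rewrite -ler_pdivrMr// TM_ge.
Qed.

(* Of two parameters [t] and [s], the larger one serves both factors. *)
Lemma fact_Mbc_mul i j : mbc i * mbc j <= mbc 0 * mbc (i + j).
Proof.
have half (i' j' : nat) (t s : R) : 0 < t -> t <= s ->
    (t ^+ i' / TM M t) * (s ^+ j' / TM M s) <= mbc 0 * mbc (i' + j').
  move=> t0 ts; have s0 := lt_le_trans t0 ts.
  apply: (@le_trans _ _ ((t ^+ 0 / TM M t) * (s ^+ (i' + j') / TM M s))); last first.
    by rewrite ler_pM ?divr_ge0 ?exprn_ge0 ?fact_Mbc_ge ?(ltW (TM_gt0 _))// ltW.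
  rewrite expr0 exprD mulrACA [leRHS]mulrACA mul1r.
  rewrite ler_wpM2r ?mulr_ge0 ?invr_ge0 ?(ltW (TM_gt0 _))//.
  rewrite ler_wpM2r ?exprn_ge0 ?(ltW s0)//.
  by apply: lerXn2r; rewrite ?nnegrE// ltW.
rewrite -ler_pdivlMr ?fact_Mbc_gt0//; apply: fact_Mbc_le => t t0.
rewrite ler_pdivlMr ?fact_Mbc_gt0// mulrC.
have tT : 0 < t ^+ i / TM M t by rewrite divr_gt0 ?TM_gt0// exprn_gt0.
rewrite -ler_pdivlMr//; apply: fact_Mbc_le => s s0.
rewrite ler_pdivlMr//; case: (leP t s) => ts; first by rewrite mulrC half.
by rewrite addnC half// ltW.
Qed.

(** Along [t0], [t0 / 2], [t0 / 4], ... the property fails eventually, and the first failure serves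
    as [t]. In this way a critical slope is located up to a factor 2. *)
Lemma threshold (P : R -> Prop) (t0 t1 : R) : 0 < t0 -> P t0 -> 0 < t1 ->
  (forall t, 0 < t -> t <= t1 -> ~ P t) -> exists2 t, 0 < t & P (2 * t) /\ ~ P t.
Proof.
move=> t00 Pt0 t10 small; apply: contrapT => none.
have Pall i : P (t0 / 2 ^+ i).
  elim: i => [|i IH]; first by rewrite expr0 divr1.
  apply: contrapT => nP; apply: none; exists (t0 / 2 ^+ i.+1).
    by rewrite divr_gt0// exprn_gt0.
  by split=> //; rewrite exprS invfM mulrCA [2 * _]mulrA mulfV// mul1r.
pose i := Num.bound (t0 / t1).
have ti : t0 / t1 < 2 ^+ i.
  apply: lt_trans (@archi_boundP _ (t0 / t1) _) _; first by rewrite divr_ge0// ltW.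
  by rewrite -natrX ltr_nat ltn_expl.
apply: (small (t0 / 2 ^+ i)) (Pall i); first by rewrite divr_gt0// exprn_gt0.
by rewrite ler_pdivrMr ?exprn_gt0// mulrC -ler_pdivrMr// ltW.
Qed.

(** A slope [t] is found with [P (2 * t)], which supplies [q], and without [P t], which forces
    T_M(t) to be attained at some [p <= k]. *)
Lemma minorant_support k : exists p q (t : R), [/\ 0 < t, (p <= k < q)%N,
  m q <= m p * (2 * t) ^+ (q - p), m q <= m 0 * (2 * t) ^+ q &
  m p * t ^+ (k - p) <= mbc k].
Proof.
(* [P t]: on the graph of ln m, some index [q > k] lies on or below every line of slope ln t through
   an index [p <= k]. *)
pose P (t : R) := exists2 q, (k < q)%N & forall p, (p <= k)%N -> m q <= m p * t ^+ (q - p).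
(* [t0] is at least 1 and at least every ratio [m k.+1 / m p], so that [q = k.+1] witnesses
   [P t0]. *)
pose t0 : R := 1 + \sum_(p < k.+1) m k.+1 / m p.
have sum0 : 0 <= \sum_(p < k.+1) m k.+1 / m p.
  by apply: sumr_ge0 => p _; rewrite divr_ge0// ltW.
have t01 : 1 <= t0 by rewrite lerDl.
have Pt0 : P t0.
  exists k.+1 => // p pk; rewrite mulrC -ler_pdivrMr//.
  apply: (@le_trans _ _ t0); last by rewrite subSn// exprS ler_peMr ?exprn_ege1// (le_trans ler01).
  have pk' : (p < k.+1)%N by [].
  rewrite /t0 (bigD1 (Ordinal pk'))//= addrCA lerDl addr_ge0//.
  by apply: sumr_ge0 => i _; rewrite divr_ge0// ltW.
have [c c0 cm] := m_superexp ltr01.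
(* For [t <= 1], [P t] with [p = 0] forces [c <= m 0 * t], which is excluded for [t <= t1]. *)
pose t1 : R := Num.min 1 (c / (2 * m 0)).
have t10 : 0 < t1 by rewrite /t1 lt_min ltr01 divr_gt0// mulr_gt0.
have small t : 0 < t -> t <= t1 -> ~ P t.
  move=> tt0; rewrite /t1 le_min => /andP[tle1 tc] [q kq] /(_ 0%N isT).
  rewrite subn0 => mq; have := cm q; rewrite expr1n mulr1 => cq.
  have tq : t ^+ q <= t.
    by rewrite -(prednK (leq_ltn_trans (leq0n k) kq)) exprS ler_piMr ?exprn_ile1// ltW.
  have : c <= m 0 * t by rewrite (le_trans cq)// (le_trans mq)// ler_pM2l.
  move: tc; rewrite ler_pdivlMr ?mulr_gt0// => tc ct.
  by have := m0 0; nra.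
have [t tt0 [[q kq Pq] nP]] := threshold (lt_le_trans ltr01 t01) Pt0 t10 small.
have [p _ pmin] := @arg_minP _ _ _ (@ord0 k) xpredT (fun p : 'I_k.+1 => m p / t ^+ p) isT.
have pk : (p <= k)%N by rewrite -ltnS ltn_ord.
exists p, q, t; split => //.
- by rewrite pk.
- exact: Pq.
- by have := Pq 0%N isT; rewrite subn0.
have tp0 i : 0 < t ^+ i by rewrite exprn_gt0.
(* [p] is minimal among the indices up to [k]; a smaller value at some [j > k] would make [j] a
   witness of [P t]. *)
have le_p j : m p / t ^+ p <= m j / t ^+ j.
  have [jk|kj] := leqP j k.
    by have := pmin (Ordinal (jk : (j < k.+1)%N)) isT.
  apply: contrapT => /negP; rewrite -ltNge => jp; apply: nP; exists j => // i ik.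
  have := pmin (Ordinal (ik : (i < k.+1)%N)) isT => /= pi.
  have := ltW (lt_le_trans jp pi); rewrite ler_pdivrMr// mulrAC -mulrA.
  by rewrite -expfB_cond ?gt_eqF//; lia.
have TE : TM M t <= t ^+ p / m p.
  apply: TM_le => j; rewrite -[t ^+ j / _]invf_div -[t ^+ p / _]invf_div.
  by rewrite lef_pV2 ?posrE ?divr_gt0.
apply: le_trans (fact_Mbc_ge k tt0); rewrite ler_pdivlMr ?TM_gt0//.
apply: le_trans (ler_wpM2l _ TE) _; first by rewrite mulr_ge0 ?ltW.
by rewrite mulrAC [t ^+ p / _]mulrC mulrA mulfV ?gt_eqF// mul1r -exprD subnKC.
Qed.
End Regularization.

(** * Derivative bounds *)

Section Estimate.
Variables (R : realType) (n : nat) (U : set 'rV[R]_n).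
Hypothesis oU : open U.
Local Notation V := 'rV[R]_n.
Local Notation e := (expR 1 : R).

(** Finiteness of the seminorm in real terms, with the weight k! M_k kept together as in the
    regularization. *)
Definition derivative_bound (M : nat -> R) (K : set V) (rho C : R) (f : V -> R) :=
  forall x vs, K x -> unit_vecs vs ->
    `|iderive f vs x| <= C * (rho ^+ size vs * ((size vs)`!%:R * M (size vs))).

Lemma seminormM_ltyP (M : nat -> R) (K : set V) (rho : R) (f : V -> R) :
  (forall k, 0 < M k) -> 0 < rho ->
  (seminormM M K rho f < +oo)%E <-> exists2 C, 0 <= C & derivative_bound M K rho C f.
Proof.
move=> M0 r0; have w0 k : 0 < rho ^+ k * (k`!%:R * M k).
  by rewrite mulr_gt0 ?exprn_gt0// mulr_gt0// ltr0n fact_gt0.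
have wE k : k`!%:R * rho ^+ k * M k = rho ^+ k * (k`!%:R * M k) by rewrite mulrCA mulrA.
split=> [h|[C C0 fC]].
  (* The value [-oo] arises when [K] is empty. *)
  have [C hC] : exists C : R, (seminormM M K rho f <= C%:E)%E.
    by case: (seminormM M K rho f) h => [r _|//|_]; [exists r|exists 0; rewrite leNye].
  exists (Num.max 0 C); first by rewrite le_max lexx.
  move=> x vs Kx uvs; rewrite -ler_pdivrMr// le_max; apply/orP; right; rewrite -lee_fin.
  apply: le_trans hC; apply: ereal_sup_ubound; exists x, (size vs), vs; split => //.
  by rewrite wE.
apply: (@le_lt_trans _ _ C%:E); last exact: ltry.
apply: ge_ereal_sup => _ [x [k [vs [Kx <- uvs ->]]]].
by rewrite lee_fin wE ler_pdivrMr// fC.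
Qed.

Lemma derivative_bound_mono (N : nat -> R) (K : set V) (rho rho' C : R) f :
  (forall k, 0 < N k) -> 0 <= C -> 0 <= rho <= rho' ->
  derivative_bound N K rho C f -> derivative_bound N K rho' C f.
Proof.
move=> N0 C0 /andP[r0 rr'] h x vs Kx uvs; apply: le_trans (h x vs Kx uvs) _.
rewrite ler_wpM2l// ler_wpM2r ?mulr_ge0 ?(ltW (N0 _))//.
by apply: lerXn2r; rewrite ?nnegrE// (le_trans r0).
Qed.

Lemma unit_vecs_coord (vs : seq V) : {subset vs <= coord_vecs R n} -> unit_vecs vs.
Proof. by move=> sub v /sub /mapP[i _ ->]; rewrite eucl_norm_delta. Qed.

Lemma coord_vecs_norm (v : V) : v \in coord_vecs R n -> `|v| <= 1.
Proof.
move=> /mapP[i _ ->]; rewrite [leLHS]/Num.norm /= mx_normrE.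
by apply/bigmax_leP; split=> // -[j k] _ /=; rewrite mxE ger0_norm// lern1 leq_b1.
Qed.

(** With [p], [q], [t] from [minorant_support] and s = 2t, one interpolates between the orders [p]
    and [q]; the hypothesis on [q] and [s] makes the radius n q / (e rho s) at most [delta]. *)
Lemma pointwise_estimate (M : nat -> R) f x (delta rho C : R) vs :
  (forall k, 0 < M k) ->
  (forall D : R, 0 < D -> exists2 c, 0 < c & forall k, c * D ^+ k <= k`!%:R * M k) ->
  smooth_on U f -> 0 < rho -> 0 <= C -> 0 <= delta ->
  (forall y, `|x - y| <= delta -> U y) ->
  derivative_bound M [set y | `|x - y| <= delta] rho C f ->
  (forall q s, (size vs < q)%N -> 0 < s -> q`!%:R * M q <= M 0 * s ^+ q ->
     n%:R * q%:R <= delta * (e * (rho * s))) ->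
  unit_vecs vs ->
  `|iderive f vs x| <= 2 ^+ n * C *
     ((2 * e * n.+1%:R * rho) ^+ size vs * ((size vs)`!%:R * Mbc M (size vs))).
Proof.
move=> M0 Msup sf rho0 C0 d0 ballU fC small uvs; set k := size vs.
have [p [q [t [t0 /andP[pk kq] mq mq0 mp]]]] := minorant_support M0 Msup k.
have Ux : U x by apply: ballU; rewrite subrr normr0.
have e0 : 0 < e by exact: expR_gt0.
have e1 : 1 <= e by rewrite -expR0 ler_expR.
pose B := 2 ^+ n * C * ((2 * e * rho) ^+ k * (k`!%:R * Mbc M k)).
have B0 : 0 <= B.
  have x0 : 0 <= 2 * e * rho by rewrite !mulr_ge0 ?(ltW e0) ?(ltW rho0).
  rewrite /B (mulr_ge0 (mulr_ge0 (exprn_ge0 _ _) C0))//.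
  by rewrite (mulr_ge0 (exprn_ge0 _ x0))// mulr_ge0// (ltW (Mbc_gt0 M0 Msup k)).
(* Coordinate directions suffice at the price of n^k, enlarged to (n+1)^k so that the constant
   replacing [rho] is positive even for [n = 0]. *)
suff coordB ws : size ws = k -> {subset ws <= coord_vecs R n} -> `|iderive f ws x| <= B.
  apply: le_trans (iderive_coord_bound oU sf Ux uvs coordB) _.
  rewrite -/k; apply: (@le_trans _ _ (n.+1%:R ^+ k * B)).
    by rewrite ler_wpM2r// lerXn2r ?nnegrE// ler_nat.
  have -> : 2 * e * n.+1%:R * rho = n.+1%:R * (2 * e * rho) by ring.
  by rewrite exprMn /B mulrCA [n.+1%:R ^+ k * (_ * _)]mulrA.
(* The [p] innermost directions [zs] go into the function being interpolated; the [k - p] others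
   remain as [us]. *)
move=> sws sub; pose zs := drop (k - p) ws; pose us := take (k - p) ws.
have sus : size us = (k - p)%N by rewrite size_take sws; case: ltnP => //; lia.
have szs : size zs = p by rewrite size_drop sws; lia.
have wsE : ws = us ++ zs by rewrite cat_take_drop.
rewrite wsE iderive_cat.
pose s := 2 * t; have s0 : 0 < s by rewrite mulr_gt0.
pose A := C * (rho ^+ p * (p`!%:R * M p)).
have A0 : 0 <= A by rewrite !mulr_ge0 ?exprn_ge0 ?(ltW rho0) ?(ltW (M0 _)).
have sz_coord : size (coord_vecs R n) = n by rewrite size_map size_enum_ord.
have pq : (p < q)%N by rewrite (leq_ltn_trans pk).
have rs0 : 0 < rho * s by rewrite mulr_gt0.
have usub : {subset us <= coord_vecs R n} by move=> v /mem_take /sub.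
have zsub : {subset zs <= coord_vecs R n} by move=> v /mem_drop /sub.
have := @iderive_interpolation R n U oU (coord_vecs R n) (coord_vecs R n) (iderive f zs)
  A (rho * s) (q - p) us x (smooth_on_iderive zs sf) A0 rs0 (@coord_vecs_norm) (fun _ h => h).
rewrite sus sz_coord => interp; apply: (le_trans (interp _ usub _)).
- exact: leq_sub2r (ltnW kq).
- move=> y xy.
  have {}xy : `|x - y| <= delta.
    apply: (le_trans xy); rewrite mulrA ler_pdivrMr ?mulr_gt0//.
    apply: le_trans (small q s kq s0 _); last by rewrite mul1r in mq0.
    by rewrite ler_wpM2l// ler_nat leq_subr.
  split; first exact: ballU.
    by rewrite /A -szs; apply: fC => //; exact: unit_vecs_coord.
  move=> ws' sws' sub'; rewrite -iderive_cat.
  have szq : size (ws' ++ zs) = q by rewrite size_cat sws' szs subnK// ltnW.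
  apply: le_trans (fC _ _ xy _) _.
    by apply: unit_vecs_coord => v; rewrite mem_cat => /orP[/sub'|/zsub].
  rewrite szq /A -!mulrA ler_wpM2l// exprMn.
  apply: le_trans (ler_wpM2l (exprn_ge0 _ (ltW rho0)) mq) _.
  rewrite -{1}(subnKC (ltnW pq)) exprD.
  by rewrite le_eqVlt; apply/orP; left; apply/eqP; rewrite -/s; ring.
rewrite [leLHS](_ : _ = 2 ^+ n * C * (rho ^+ p * (p`!%:R * M p) * (e * (rho * s)) ^+ (k - p)));
  last by rewrite /A !mulrA.
rewrite /B ler_wpM2l ?mulr_ge0 ?exprn_ge0//.
have -> : e * (rho * s) = (2 * e * rho) * t by rewrite /s; ring.
rewrite exprMn.
apply: (@le_trans _ _ ((2 * e * rho) ^+ k * (p`!%:R * M p * t ^+ (k - p)))).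
  rewrite -(subnKC pk) exprD addKn.
  have : rho ^+ p <= (2 * e * rho) ^+ p.
    apply: lerXn2r; rewrite ?nnegrE ?mulr_ge0 ?(ltW e0) ?(ltW rho0)//.
    by rewrite -[leLHS]mul1r ler_wpM2r ?(ltW rho0)//; lra.
  have h0 : 0 <= (p`!%:R * M p) * ((2 * e * rho) ^+ (k - p) * t ^+ (k - p)).
    by rewrite !mulr_ge0 ?exprn_ge0 ?mulr_ge0 ?(ltW e0) ?(ltW rho0) ?(ltW t0) ?(ltW (M0 _)).
  move=> /(ler_wpM2r h0) h.
  have leE (a b : R) : a = b -> a <= b by move=> ->.
  by apply: (le_trans (leE _ _ _) (le_trans h (leE _ _ _))); ring.
by rewrite ler_wpM2l// exprn_ge0// !mulr_ge0 ?(ltW e0) ?(ltW rho0).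
Qed.
End Estimate.

(** * Growth of the weight sequence *)

Section Growth.
Variable R : realType.
Implicit Types (M b m : nat -> R).
Local Notation e := (expR 1 : R).

Lemma eventually_le_scaled b m N : (forall k, 0 < b k) -> (forall k, 0 < m k) ->
  (forall k, (N <= k)%N -> b k <= m k) -> exists2 c, 0 < c & forall k, c * b k <= m k.
Proof.
move=> b0 m0 bm; pose S := \sum_(k < N) b k / m k.
have bm0 k : 0 <= b k / m k by rewrite divr_ge0// ltW.
have S0 : 0 <= S by apply: sumr_ge0.
have S1 : 0 < 1 + S by rewrite ltr_wpDr.
(* [1 + S] dominates the ratios [b k / m k] for [k < N] through [S], and the others through 1. *)
exists (1 + S)^-1; first by rewrite invr_gt0.
move=> k; rewrite ler_pdivrMl// -ler_pdivrMr//; have [kN|Nk] := ltnP k N.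
  rewrite /S (bigD1 (Ordinal kN))//= addrCA lerDl addr_ge0//.
  by apply: sumr_ge0.
by apply: (@le_trans _ _ 1); rewrite ?lerDl// ler_pdivrMr// mul1r bm.
Qed.

Lemma Mroot_exp M k : 0 < M k -> (0 < k)%N -> Mroot M k ^+ k = M k.
Proof.
move=> Mk k0; rewrite -powR_mulrn ?powR_ge0// -powRrM mulVf ?powRr1 ?ltW//.
by rewrite pnatr_eq0 -lt0n.
Qed.

Lemma Mroot_growth M (D : R) : (forall k, 0 < M k) -> 0 < D ->
  (\forall k \near \oo, D <= Mroot M k) -> exists2 c, 0 < c & forall k, c * D ^+ k <= M k.
Proof.
(* Starting at [N.+1] leaves out [k = 0], where the exponent in [Mroot] is 0. *)
move=> M0 D0 [N _ NM]; apply: (@eventually_le_scaled _ _ N.+1) => //.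
  by move=> k; rewrite exprn_gt0.
move=> k Nk; rewrite -(Mroot_exp (M0 k)); last exact: leq_trans Nk.
apply: lerXn2r; rewrite ?nnegrE ?powR_ge0 ?(ltW D0)//.
by apply: NM => /=; exact: ltnW.
Qed.

Lemma limn_einf_gt0 M : (0 < limn_einf (fun k => (Mroot M k)%:E))%E ->
  exists2 D, 0 < D & \forall k \near \oo, D <= Mroot M k.
Proof.
rewrite limn_einf_lim (cvg_lim _ (@cvg_einfs_sup _ _))// => /ereal_sup_gt[_ [N _ <-]].
move=> h.
have [D D0 DN] : exists2 D : R, 0 < D & (D%:E <= einfs (fun k => (Mroot M k)%:E) N)%E.
  case: (einfs _ N) h => [r|_|//]; last by exists 1; rewrite ?leey.
  by rewrite lte_fin => r0; exists r.
exists D => //; exists N => // k /= Nk; rewrite -lee_fin (le_trans DN)//.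
by apply: ereal_inf_lbound; exists k.
Qed.

(** By k! >= (k / e)^k, the product k! D^k dominates D'^k once k D >= e D'. *)
Lemma growth_superexp M (c D : R) : (forall k, 0 < M k) -> 0 < c -> 0 < D ->
  (forall k, c * D ^+ k <= M k) ->
  forall D' : R, 0 < D' -> exists2 c', 0 < c' & forall k, c' * D' ^+ k <= k`!%:R * M k.
Proof.
move=> M0 c0 D0 cM D' D'0; have e0 : 0 < e by exact: expR_gt0.
pose N := Num.bound (D' * e / D).
have [||k Nk|c1 c10 h] := @eventually_le_scaled (fun k => D' ^+ k) (fun k => k`!%:R * D ^+ k) N.
- by move=> k; rewrite exprn_gt0.
- by move=> k; rewrite mulr_gt0 ?exprn_gt0// ltr0n fact_gt0.
- have kD : D' * e <= k%:R * D.
    rewrite -ler_pdivrMr// (le_trans (ltW (archi_boundP _)))//.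
      by rewrite divr_ge0 ?mulr_ge0// ltW.
    by rewrite ler_nat.
  rewrite -(ler_pM2r (exprn_gt0 k e0)) -exprMn.
  apply: (@le_trans _ _ ((k%:R * D) ^+ k)).
    by apply: lerXn2r; rewrite ?nnegrE ?mulr_ge0 ?(ltW D'0) ?(ltW D0) ?(ltW e0).
  rewrite exprMn -mulrA [_ * e ^+ k]mulrC mulrA ler_wpM2r ?exprn_ge0 ?(ltW D0)//.
  by rewrite mulrC exprnn_le_fact.
exists (c * c1); first by rewrite mulr_gt0.
move=> k; rewrite -mulrA; apply: le_trans (ler_wpM2l (ltW c0) (h k)) _.
by rewrite mulrCA ler_wpM2l.
Qed.

(** One takes [q]-th roots after using q! >= (q / e)^q and M_q >= c D^q; [a] lies below (c /
    M_0)^(1/q). This controls the interpolation radius, which is proportional to q / (e s). *)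
Lemma growth_lower M (c D a s : R) q : (forall k, 0 < M k) -> 0 < D -> 0 < a -> 0 < s ->
  (forall k, c * D ^+ k <= M k) -> (0 < q)%N -> a ^+ q <= c / M 0 ->
  q`!%:R * M q <= M 0 * s ^+ q -> a * D * q%:R <= e * s.
Proof.
move=> M0 D0 a0 s0 cM q0 ac h; have e0 : 0 < e by exact: expR_gt0.
rewrite -(@ler_pXn2r _ q) ?nnegrE ?mulr_ge0 ?(ltW a0) ?(ltW D0) ?(ltW s0) ?(ltW e0)//.
rewrite -(ler_pM2l (M0 0)) !exprMn.
have Dq : 0 <= D ^+ q by rewrite exprn_ge0 ?ltW.
apply: (@le_trans _ _ (c * D ^+ q * (e ^+ q * q`!%:R))).
  rewrite !mulrA -[leRHS]mulrA; apply: ler_pM; last exact: exprnn_le_fact.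
  - by rewrite !mulr_ge0 ?exprn_ge0 ?(ltW a0) ?(ltW D0) ?(ltW (M0 _)).
  - by rewrite exprn_ge0.
  - by rewrite ler_wpM2r// mulrC -ler_pdivlMr.
apply: (@le_trans _ _ (M q * (e ^+ q * q`!%:R))).
  by rewrite ler_wpM2r// mulr_ge0// exprn_ge0// ltW.
rewrite mulrCA [M 0 * _]mulrCA ler_wpM2l ?exprn_ge0 ?(ltW e0)//.
by rewrite mulrC.
Qed.
End Growth.

(** * The two inclusions for each class *)

Section Inclusions.
Variables (R : realType) (n : nat) (U : set 'rV[R]_n) (M : nat -> R).
Hypothesis oU : open U.
Hypothesis M0 : forall k, 0 < M k.
Local Notation V := 'rV[R]_n.
Local Notation e := (expR 1 : R).

(** For the maximum norm a closed ball is a product of segments. *)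
Lemma compact_closed_ball0 (d : R) : compact [set v : V | `|v| <= d].
Proof.
have [d0|d0] := ltP d 0.
  rewrite (_ : [set v | _] = set0); first exact: compact0.
  apply/seteqP; split=> // v /= vd.
  by have := le_lt_trans (le_trans (normr_ge0 v) vd) d0; rewrite ltxx.
have := @rV_compact R n (fun=> `[- d, d]%classic) (fun=> @segment_compact R (- d) d).
congr compact; apply/seteqP; split=> v /=.
  move=> h; rewrite [leLHS]/Num.norm /= mx_normrE; apply/bigmax_leP; split=> // -[i j] _ /=.
  by rewrite ord1; have := h j; rewrite in_itv/= ler_norml.
move=> vd i; rewrite in_itv/= -ler_norml; apply: le_trans vd.
rewrite [leRHS]/Num.norm /= mx_normrE; apply/bigmax_geP; right.
by exists (ord0, i).
Qed.

(** [K'] is the sum of [K] and a closed ball, hence the image of a compact product under addition; a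
    uniform [d] comes from the covering property of [K]. *)
Lemma compact_thickening (K : set V) : compact K -> K `<=` U ->
  exists2 d : R, 0 < d & exists2 K' : set V, compact K' /\ K' `<=` U &
    forall x y, K x -> `|x - y| <= d -> K' y.
Proof.
move=> cK KU.
have [d d0 dP] : exists2 d : R, 0 < d & forall x y, K x -> `|x - y| <= d -> U y.
  have /compact_near_coveringP := cK.
  move=> /(_ R 0^'+ (fun d x => forall y, `|x - y| <= d -> U y) _) h.
  have {h} : \forall d \near 0^'+, K `<=` [set x | forall y, `|x - y| <= d -> U y].
    apply: h => x Kx.
    have /nbhs_ballP[r /= r0 rU] : nbhs x U by apply: open_nbhs_nbhs; split=> //; exact: KU.
    have r2 : 0 < r / 2 by rewrite divr_gt0.
    exists (ball x (r / 2), [set d | 0 < d < r / 2]) => /=.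
      split; first exact: nbhsx_ballx.
      by near=> d; apply/andP; split; near: d; [exact: nbhs_right_gt|exact: nbhs_right_lt].
    move=> [x' d] /= [+ /andP[_ dr]] y x'y; rewrite -ball_normE /= => xx'.
    apply: rU; rewrite -ball_normE /=; apply: le_lt_trans (ler_distD x' _ _) _.
    by rewrite (splitr r) ltrD// (le_lt_trans x'y).
  move=> h; have [d [d0 dK]] : exists d : R, 0 < d /\ (K `<=` [set x | forall y, `|x - y| <= d -> U y]).
    have [d [d0 dK]] := @filter_ex _ _ (at_right_proper_filter (0 : R)) _
      (filterI (nbhs_right_gt (0 : R)) h).
    by exists d.
  by exists d => // x y Kx; exact: dK.
exists d => //.
exists ((fun p : V * V => p.1 + p.2) @` (K `*` [set v | `|v| <= d])).
  split.
    apply: continuous_compact; last first.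
      by apply: compact_setX => //; exact: compact_closed_ball0.
    by apply: continuous_subspaceT => p; exact: add_continuous.
  move=> _ [[x v] /= [Kx vd] <-]; apply: (dP x) => //.
  by rewrite opprD addNKr normrN.
move=> x y Kx xy; exists (x, y - x) => /=; last by rewrite addrC subrK.
by split=> //; rewrite distrC.
Unshelve. all: by end_near. Qed.

Section Superexponential.
Hypothesis Msup :
  forall D : R, 0 < D -> exists2 c, 0 < c & forall k, c * D ^+ k <= k`!%:R * M k.

Lemma derivative_bound_Mbc (K : set V) (rho C : R) f :
  0 <= rho -> 0 <= C -> derivative_bound (Mbc M) K rho C f -> derivative_bound M K rho C f.
Proof.
move=> r0 C0 h x vs Kx uvs; apply: le_trans (h x vs Kx uvs) _.
by rewrite ler_wpM2l// ler_wpM2l ?exprn_ge0// ler_wpM2l// Mbc_le.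
Qed.

Lemma E_Roumieu_Mbc_sub : E_Roumieu (Mbc M) U `<=` E_Roumieu M U.
Proof.
move=> f [sf h]; split=> // K KU cK; have [rho [rho0 hr]] := h K KU cK.
exists rho; split=> //; apply/(seminormM_ltyP _ _ M0 rho0).
have /(seminormM_ltyP _ _ (Mbc_gt0 M0 Msup) rho0)[C C0 fC] := hr.
by exists C => //; apply: derivative_bound_Mbc => //; exact: ltW.
Qed.

Lemma E_Beurling_Mbc_sub : E_Beurling (Mbc M) U `<=` E_Beurling M U.
Proof.
move=> f [sf h]; split=> // K KU cK rho rho0; have hr := h K KU cK rho rho0.
apply/(seminormM_ltyP _ _ M0 rho0).
have /(seminormM_ltyP _ _ (Mbc_gt0 M0 Msup) rho0)[C C0 fC] := hr.
by exists C => //; apply: derivative_bound_Mbc => //; exact: ltW.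
Qed.

(** In the Roumieu class [rho] may be enlarged, and [rho1] is taken so large that the interpolation
    radius is at most [d]. *)
Lemma E_Roumieu_sub_Mbc (c D : R) : 0 < c -> 0 < D -> (forall k, c * D ^+ k <= M k) ->
  E_Roumieu M U `<=` E_Roumieu (Mbc M) U.
Proof.
move=> c0 D0 cM f [sf h]; split=> // K KU cK.
have [d d0 [K' [cK' K'U] KK']] := compact_thickening cK KU.
have [rho [rho0 hr]] := h K' K'U cK'.
have /(seminormM_ltyP _ _ M0 rho0)[C C0 fC] := hr.
(* Index 0 gives [a <= 1], hence [a ^+ q <= c / M 0] for every [q > 0]. *)
pose a := c / M 0; have a0 : 0 < a by rewrite divr_gt0.
have a1 : a <= 1 by rewrite ler_pdivrMr// mul1r; have := cM 0%N; rewrite expr0 mulr1.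
pose rho1 := Num.max rho (n%:R / (d * a * D)).
have r01 : rho <= rho1 by rewrite le_max lexx.
have rho10 : 0 < rho1 by exact: lt_le_trans r01.
have {}fC : derivative_bound M K' rho1 C f.
  by apply: derivative_bound_mono fC => //; rewrite (ltW rho0).
have e0 : 0 < e by exact: expR_gt0.
have rho'0 : 0 < 2 * e * n.+1%:R * rho1 by rewrite !mulr_gt0.
exists (2 * e * n.+1%:R * rho1); split=> //.
apply/(seminormM_ltyP _ _ (Mbc_gt0 M0 Msup) rho'0).
exists (2 ^+ n * C); first by rewrite mulr_ge0// exprn_ge0.
move=> x vs Kx uvs; apply: (@pointwise_estimate R n U oU M f x d rho1 C vs) => //.
- exact: ltW.
- by move=> y xy; apply: K'U; exact: KK' xy.
- by move=> y ws /= xy; apply: fC; exact: KK' xy.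
move=> q s kq s0 hq; have q0 : (0 < q)%N by exact: leq_ltn_trans kq.
have aq : a ^+ q <= c / M 0.
  by rewrite -/a -(prednK q0) exprS ler_piMr ?(ltW a0)// exprn_ile1// ltW.
have := growth_lower M0 D0 a0 s0 cM q0 aq hq => hs.
have nr : n%:R <= d * a * D * rho1.
  by rewrite mulrC -ler_pdivrMr ?(mulr_gt0 (mulr_gt0 d0 a0) D0)// le_max lexx orbT.
have dr : 0 <= d * rho1 by rewrite mulr_ge0 ?ltW.
have h1 := ler_wpM2l dr hs; have h2 := ler_wpM2r (ler0n R q) nr.
apply: le_trans h2 _.
rewrite [leLHS](_ : _ = d * rho1 * (a * D * q%:R)); last by ring.
by apply: le_trans h1 _; rewrite le_eqVlt; apply/orP; left; apply/eqP; ring.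
Qed.

(** Here [rho] is prescribed and the radius is made small by a large [D]. As [c] depends on [D], the
    factor [c / M 0] of the Roumieu case gives way to [2^-1], valid for orders from [k0] on; the
    finitely many lower orders are bounded separately. *)
Lemma E_Beurling_sub_Mbc :
  (forall D : R, 0 < D -> exists2 c, 0 < c & forall k, c * D ^+ k <= M k) ->
  E_Beurling M U `<=` E_Beurling (Mbc M) U.
Proof.
move=> cM f [sf h]; split=> // K KU cK rho' rho'0.
have [d d0 [K' [cK' K'U] KK']] := compact_thickening cK KU.
have e0 : 0 < e by exact: expR_gt0.
have en0 : 0 < 2 * e * n.+1%:R by rewrite !mulr_gt0.
have [rho rho0 rhoE] : exists2 rho, 0 < rho & 2 * e * n.+1%:R * rho = rho'.
  exists (rho' / (2 * e * n.+1%:R)); first by rewrite divr_gt0.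
  by rewrite mulrC divfK ?gt_eqF.
have /(seminormM_ltyP _ _ M0 rho0)[C C0 fC] := h K' K'U cK' rho rho0.
(* Chosen so that [d * rho * D / 2] is at least [n]. *)
pose D := 1 + 2 * n%:R / (d * rho).
have D0 : 0 < D.
  by rewrite /D ltr_wpDr// divr_ge0 ?mulr_ge0 ?(ltW d0) ?(ltW rho0).
have nD : n%:R <= d * rho * (2^-1 * D).
  have -> : d * rho * (2^-1 * D) = d * rho / 2 + n%:R.
    by rewrite /D; field; rewrite !gt_eqF.
  by rewrite lerDr divr_ge0// mulr_ge0 ?(ltW d0) ?(ltW rho0).
have [c c0 {}cM] := cM D D0.
pose k0 := Num.bound (M 0 / c).
have half q : (k0 <= q)%N -> 2^-1 ^+ q <= c / M 0.
  move=> kq; rewrite exprVn -[c / M 0]invf_div lef_pV2 ?posrE ?divr_gt0 ?exprn_gt0//.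
  apply: le_trans (ltW (archi_boundP _)) _; first by rewrite divr_ge0// ltW.
  by rewrite -natrX ler_nat (leq_trans kq)// ltnW// ltn_expl.
pose w k := rho' ^+ k * (k`!%:R * Mbc M k).
pose w' k := rho ^+ k * (k`!%:R * M k).
have w0 k : 0 < w k.
  apply: mulr_gt0; first exact: exprn_gt0.
  by apply: mulr_gt0; [rewrite ltr0n fact_gt0 | exact: (Mbc_gt0 M0 Msup)].
have w'0 k : 0 < w' k by rewrite !mulr_gt0 ?exprn_gt0 ?ltr0n ?fact_gt0.
pose S := \sum_(k < k0) w' k / w k.
have ww0 k : 0 <= w' k / w k by rewrite divr_ge0// ltW.
have S0 : 0 <= S by apply: sumr_ge0.
have C20 : 0 <= 2 ^+ n * C by rewrite mulr_ge0// exprn_ge0.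
apply/(seminormM_ltyP _ _ (Mbc_gt0 M0 Msup) rho'0).
exists (2 ^+ n * C + C * S); first by rewrite addr_ge0// mulr_ge0.
(* Below [k0] the bound for [M] itself is used, [S] absorbing the ratios of the weights. *)
move=> x vs Kx uvs; rewrite -/(w (size vs)); have [kk0|k0k] := ltnP (size vs) k0.
  apply: (@le_trans _ _ (C * w' (size vs))).
    by apply: fC => //; apply: (KK' x x) => //; rewrite subrr normr0 ltW.
  apply: (@le_trans _ _ (C * S * w (size vs))); last first.
    by rewrite ler_wpM2r ?(ltW (w0 _))// lerDr.
  rewrite -mulrA ler_wpM2l// -ler_pdivrMr// /S (bigD1 (Ordinal kk0))//= lerDl.
  by apply: sumr_ge0.
apply: (@le_trans _ _ (2 ^+ n * C * w (size vs))); last first.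
  by rewrite ler_wpM2r ?(ltW (w0 _))// lerDl mulr_ge0.
rewrite /w -rhoE; apply: (@pointwise_estimate R n U oU M f x d rho C vs) => //.
- exact: ltW.
- by move=> y xy; apply: K'U; exact: KK' xy.
- by move=> y ws /= xy; apply: fC; exact: KK' xy.
move=> q s kq s0 hq; have q0 : (0 < q)%N by exact: leq_ltn_trans kq.
have half0 : 0 < 2^-1 :> R by rewrite invr_gt0.
have := growth_lower M0 D0 half0 s0 cM q0 (half q (leq_trans k0k (ltnW kq))) hq => hs.
have dr : 0 <= d * rho by rewrite mulr_ge0 ?(ltW d0) ?(ltW rho0).
have h1 := ler_wpM2l dr hs; have h2 := ler_wpM2r (ler0n R q) nD.
apply: le_trans h2 _.
rewrite [leLHS](_ : _ = d * rho * (2^-1 * D * q%:R)); last by rewrite !mulrA.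
apply: le_trans h1 _.
by rewrite le_eqVlt; apply/orP; left; apply/eqP; ring.
Qed.
End Superexponential.
End Inclusions.

(** * The algebra property *)

Section Leibniz.
Variables (R : realType) (n : nat) (U : set 'rV[R]_n).
Hypothesis oU : open U.
Local Notation V := 'rV[R]_n.
Implicit Types (f g : V -> R) (x v : V) (vs : seq V).

(** The 2^k terms of Leibniz' rule for [k] directions, listed one by one in place of binomial
    coefficients. *)
Fixpoint splits vs : seq (seq V * seq V) :=
  if vs is v :: vs' then
    [seq (v :: p.1, p.2) | p <- splits vs'] ++ [seq (p.1, v :: p.2) | p <- splits vs']
  else [:: ([::], [::])].

Lemma size_splits vs : size (splits vs) = (2 ^ size vs)%N.
Proof. by elim: vs => //= v vs IH; rewrite size_cat !size_map IH expnS mul2n addnn. Qed.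

Lemma mem_splits vs p : p \in splits vs ->
  [/\ (size p.1 + size p.2)%N = size vs, {subset p.1 <= vs} & {subset p.2 <= vs}].
Proof.
elim: vs p => [|v vs IH] p /=; first by rewrite inE => /eqP ->.
rewrite mem_cat => /orP[] /mapP[q /IH[sq s1 s2] ->] /=; split.
- by rewrite addSn sq.
- by move=> w; rewrite !inE => /orP[->//|/s1 ->]; rewrite orbT.
- by move=> w /s2; rewrite inE => ->; rewrite orbT.
- by rewrite addnS sq.
- by move=> w /s1; rewrite inE => ->; rewrite orbT.
- by move=> w; rewrite !inE => /orP[->//|/s2 ->]; rewrite orbT.
Qed.

Definition leibniz_sum f g (s : seq (seq V * seq V)) x :=
  \sum_(p <- s) iderive f p.1 x * iderive g p.2 x.

Lemma leibniz_sum_cons f g p s :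
  leibniz_sum f g (p :: s) = iderive f p.1 * iderive g p.2 + leibniz_sum f g s.
Proof. by apply/funext => x; rewrite /leibniz_sum big_cons. Qed.

Lemma leibniz_sum_nil f g : leibniz_sum f g [::] = cst 0.
Proof. by apply/funext => x; rewrite /leibniz_sum big_nil. Qed.

Lemma is_derive_leibniz_sum f g s x v : smooth_on U f -> smooth_on U g -> U x ->
  is_derive x v (leibniz_sum f g s)
    (leibniz_sum f g ([seq (v :: p.1, p.2) | p <- s] ++ [seq (p.1, v :: p.2) | p <- s]) x).
Proof.
move=> sf sg Ux; elim: s => [|p s IH].
  by rewrite /= !leibniz_sum_nil; exact: is_derive_cst.
have df := derivableP (@smooth_on_derivable _ _ _ _ x v (smooth_on_iderive p.1 sf) Ux).
have dg := derivableP (@smooth_on_derivable _ _ _ _ x v (smooth_on_iderive p.2 sg) Ux).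
have := @is_deriveD _ _ _ _ _ _ _ _ _ (@is_deriveM _ _ _ _ _ _ _ _ df dg) IH.
rewrite -leibniz_sum_cons => h; apply: (is_derive_eq h).
rewrite /leibniz_sum !big_cat /= !big_cons /= -![_ *: _]/(_ * _).
by rewrite [iderive g _ x * _]mulrC [X in X + _]addrC addrACA.
Qed.

Lemma continuous_leibniz_sum f g s x : smooth_on U f -> smooth_on U g -> U x ->
  {for x, continuous (leibniz_sum f g s)}.
Proof.
move=> sf sg Ux; elim: s => [|p s IH].
  by rewrite leibniz_sum_nil; exact: cst_continuous.
have cf := smooth_on_continuous (smooth_on_iderive p.1 sf) Ux.
have cg := smooth_on_continuous (smooth_on_iderive p.2 sg) Ux.
rewrite leibniz_sum_cons; apply: (@cvgD _ _ _ (nbhs x)) => //.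
exact: (@cvgM _ _ (nbhs x)).
Qed.

Lemma iderive_mul f g vs : smooth_on U f -> smooth_on U g ->
  {in U, iderive (f \* g) vs =1 leibniz_sum f g (splits vs)}.
Proof.
move=> sf sg; elim: vs => [|v vs IH] x; first by rewrite /leibniz_sum big_seq1.
move=> Ux; apply: etrans (iderive_eq_on oU [:: v] IH Ux) _; move: Ux; rewrite inE => Ux.
by have [] := is_derive_leibniz_sum (splits vs) v sf sg Ux.
Qed.

Lemma smooth_on_mul f g : smooth_on U f -> smooth_on U g -> smooth_on U (f \* g).
Proof.
move=> sf sg vs.
have E : {in U, leibniz_sum f g (splits vs) =1 iderive (f \* g) vs}.
  by move=> x Ux; rewrite iderive_mul.
split=> [x|v x Ux].
  rewrite inE => Ux; apply: (eq_on_continuous oU E Ux).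
  exact: continuous_leibniz_sum.
apply: (eq_on_derivable oU E Ux).
by have [] := is_derive_leibniz_sum (splits vs) v sf sg Ux.
Qed.

Lemma iderive_add f g vs : smooth_on U f -> smooth_on U g ->
  {in U, iderive (f \+ g) vs =1 iderive f vs + iderive g vs}.
Proof.
move=> sf sg; elim: vs => // v vs IH x Ux.
apply: etrans (iderive_eq_on oU [:: v] IH Ux) _; move: Ux; rewrite inE => Ux.
by rewrite /= deriveD//; apply: smooth_on_derivable Ux; exact: smooth_on_iderive.
Qed.

Lemma smooth_on_add f g : smooth_on U f -> smooth_on U g -> smooth_on U (f \+ g).
Proof.
move=> sf sg vs.
have E : {in U, iderive f vs + iderive g vs =1 iderive (f \+ g) vs}.
  by move=> x Ux; rewrite iderive_add.
split=> [x|v x Ux].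
  rewrite inE => Ux; apply: (eq_on_continuous oU E Ux).
  apply: (@cvgD _ _ _ (nbhs x)).
    exact: (smooth_on_continuous (smooth_on_iderive vs sf) Ux).
  exact: (smooth_on_continuous (smooth_on_iderive vs sg) Ux).
apply: (eq_on_derivable oU E Ux).
by apply: derivableD; apply: smooth_on_derivable Ux; exact: smooth_on_iderive.
Qed.

Lemma iderive_cst (a : R) vs :
  iderive (fun _ : V => a) vs = fun=> if vs is [::] then a else 0.
Proof.
elim: vs => // v vs IH /=; apply/funext => x; rewrite IH.
exact: derive_cst.
Qed.

Lemma smooth_on_cst (a : R) : smooth_on U (fun _ : V => a).
Proof.
move=> vs; rewrite iderive_cst; split=> [x _|v x _]; first exact: cst_continuous.
exact: derivable_cst.
Qed.
End Leibniz.

(** * Stability under sums and products *)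

Section Algebra.
Variables (R : realType) (n : nat) (U : set 'rV[R]_n) (N : nat -> R) (a : R).
Hypothesis oU : open U.
Hypothesis N0 : forall k, 0 < N k.
Hypothesis a0 : 0 <= a.
(** For [Mbc M] this is [fact_Mbc_mul], with [a] equal to 0! Mbc_0. *)
Hypothesis N_mul : forall i j,
  (i`!%:R * N i) * (j`!%:R * N j) <= a * ((i + j)`!%:R * N (i + j)%N).
Local Notation V := 'rV[R]_n.
Implicit Types (f g : V -> R) (K : set V) (rho C : R).

Let w0 rho k : 0 < rho -> 0 < rho ^+ k * (k`!%:R * N k).
Proof. by move=> r0; rewrite mulr_gt0 ?exprn_gt0// mulr_gt0// ltr0n fact_gt0. Qed.

(** Each of the 2^k terms of Leibniz' rule is at most [C * C' * a] times the weight for [rho], and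
    their number is absorbed by [2 * rho]. *)
Lemma derivative_bound_mul f g K rho C C' : smooth_on U f -> smooth_on U g ->
  K `<=` U -> 0 < rho -> 0 <= C -> 0 <= C' ->
  derivative_bound N K rho C f -> derivative_bound N K rho C' g ->
  derivative_bound N K (2 * rho) (C * C' * a) (f \* g).
Proof.
move=> sf sg KU r0 C0 C'0 fC gC x vs Kx uvs.
have Ux : x \in U by rewrite inE; exact: KU.
rewrite (iderive_mul oU _ sf sg Ux) /leibniz_sum big_seq.
apply: le_trans (ler_norm_sum _ _ _) _.
pose B := C * C' * a * (rho ^+ size vs * ((size vs)`!%:R * N (size vs))).
apply: (@le_trans _ _ (\sum_(p <- splits vs | p \in splits vs) B)).
  apply: ler_sum => p /mem_splits[sp s1 s2]; rewrite normrM.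
  have u1 : unit_vecs p.1 by move=> v /s1 /uvs.
  have u2 : unit_vecs p.2 by move=> v /s2 /uvs.
  apply: le_trans (ler_pM _ _ (fC x _ Kx u1) (gC x _ Kx u2)) _ => //.
  rewrite mulrACA [rho ^+ _ * _ * _]mulrACA -exprD sp /B -[C * C' * a * _]mulrA ler_wpM2l ?mulr_ge0//.
  by rewrite [leRHS]mulrCA ler_wpM2l ?exprn_ge0 ?(ltW r0)// -sp N_mul.
rewrite -big_seq big_const_seq count_predT size_splits.
rewrite iter_addr_0 -[leLHS]mulr_natl natrX.
rewrite /B exprMn le_eqVlt; apply/orP; left; apply/eqP.
by rewrite mulrCA [2 ^+ _ * (_ * _)]mulrA.
Qed.

Lemma derivative_bound_add f g K rho C C' : smooth_on U f -> smooth_on U g -> K `<=` U ->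
  derivative_bound N K rho C f -> derivative_bound N K rho C' g ->
  derivative_bound N K rho (C + C') (f \+ g).
Proof.
move=> sf sg KU fC gC x vs Kx uvs.
have Ux : x \in U by rewrite inE; exact: KU.
rewrite (iderive_add oU _ sf sg Ux) mulrDl.
by apply: le_trans (ler_normD _ _) _; rewrite lerD ?fC ?gC.
Qed.

Lemma derivative_bound_cst (b : R) K rho : 0 < rho ->
  derivative_bound N K rho (`|b| / N 0) (fun=> b).
Proof.
move=> r0 x vs Kx uvs; rewrite iderive_cst; case: vs uvs => [|v vs] _ /=.
  by rewrite mul1r mul1r divfK// gt_eqF.
by rewrite normr0 mulr_ge0 ?divr_ge0 ?(ltW (N0 _)) ?(ltW (w0 _ _)).
Qed.

Lemma E_Beurling_algebra : is_fun_algebra (E_Beurling N U).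
Proof.
have cstE b : E_Beurling N U (fun=> b).
  split; first exact: smooth_on_cst.
  move=> K KU cK rho r0; apply/(seminormM_ltyP _ _ N0 r0).
  exists (`|b| / N 0); first by rewrite divr_ge0// ltW.
  exact: derivative_bound_cst.
have mulE f g : E_Beurling N U f -> E_Beurling N U g -> E_Beurling N U (f \* g).
  move=> [sf hf] [sg hg]; split; first exact: smooth_on_mul.
  (* The product rule doubles the parameter, so both factors are taken at [rho / 2]. *)
  move=> K KU cK rho r0; have r20 : 0 < rho / 2 by rewrite divr_gt0.
  have /(seminormM_ltyP _ _ N0 r20)[C C0 fC] := hf K KU cK _ r20.
  have /(seminormM_ltyP _ _ N0 r20)[C' C'0 gC] := hg K KU cK _ r20.
  apply/(seminormM_ltyP _ _ N0 r0); exists (C * C' * a); first by rewrite !mulr_ge0.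
  have := derivative_bound_mul sf sg KU r20 C0 C'0 fC gC.
  by rewrite mulrC divfK.
(* Scalar multiples are products with constant functions. *)
split=> [||b f fE|]; [exact: cstE| |exact: mulE|exact: mulE].
move=> f g [sf hf] [sg hg]; split; first exact: smooth_on_add.
move=> K KU cK rho r0.
have /(seminormM_ltyP _ _ N0 r0)[C C0 fC] := hf K KU cK _ r0.
have /(seminormM_ltyP _ _ N0 r0)[C' C'0 gC] := hg K KU cK _ r0.
apply/(seminormM_ltyP _ _ N0 r0); exists (C + C'); first by rewrite addr_ge0.
exact: derivative_bound_add.
Qed.

Lemma E_Roumieu_algebra : is_fun_algebra (E_Roumieu N U).
Proof.
have cstE b : E_Roumieu N U (fun=> b).
  split; first exact: smooth_on_cst.
  move=> K KU cK; exists 1; split=> //; apply/(seminormM_ltyP _ _ N0 ltr01).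
  exists (`|b| / N 0); first by rewrite divr_ge0// ltW.
  exact: derivative_bound_cst.
(* The larger of the two parameters serves both functions. *)
have common f g K : E_Roumieu N U f -> E_Roumieu N U g -> K `<=` U -> compact K ->
    exists rho C C', [/\ 0 < rho, 0 <= C, 0 <= C',
      derivative_bound N K rho C f & derivative_bound N K rho C' g].
  move=> [_ hf] [_ hg] KU cK.
  have [r1 [r10 /(seminormM_ltyP _ _ N0 r10)[C C0 fC]]] := hf K KU cK.
  have [r2 [r20 /(seminormM_ltyP _ _ N0 r20)[C' C'0 gC]]] := hg K KU cK.
  exists (Num.max r1 r2), C, C'; split=> //; first by rewrite lt_max r10.
    by apply: derivative_bound_mono fC => //; rewrite (ltW r10) le_max lexx.
  by apply: derivative_bound_mono gC => //; rewrite (ltW r20) le_max lexx orbT.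
have mulE f g : E_Roumieu N U f -> E_Roumieu N U g -> E_Roumieu N U (f \* g).
  move=> Ef Eg; split; first by case: Ef Eg => sf _ [sg _]; exact: smooth_on_mul.
  move=> K KU cK; have [r [C [C' [r0 C0 C'0 fC gC]]]] := common f g K Ef Eg KU cK.
  have r20 : 0 < 2 * r by rewrite mulr_gt0.
  exists (2 * r); split=> //; apply/(seminormM_ltyP _ _ N0 r20).
  exists (C * C' * a); first by rewrite !mulr_ge0.
  by case: Ef Eg => sf _ [sg _]; exact: derivative_bound_mul.
split=> [||b f fE|]; [exact: cstE| |exact: mulE|exact: mulE].
move=> f g Ef Eg; split; first by case: Ef Eg => sf _ [sg _]; exact: smooth_on_add.
move=> K KU cK; have [r [C [C' [r0 C0 C'0 fC gC]]]] := common f g K Ef Eg KU cK.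
exists r; split=> //; apply/(seminormM_ltyP _ _ N0 r0).
exists (C + C'); first by rewrite addr_ge0.
by case: Ef Eg => sf _ [sg _]; exact: derivative_bound_add.
Qed.
End Algebra.

(** * Equality of the spaces and transfer of the algebra property *)

Unset Implicit Arguments.

Theorem theorem2p15 (R : realType) (n : nat) (M : nat -> R) (U : set 'rV[R]_n) :
  (forall k, 0 < M k) -> open U ->
  ((0 < limn_einf (fun k => (Mroot M k)%:E))%E ->
     E_Roumieu M U = E_Roumieu (Mbc M) U /\ is_fun_algebra (E_Roumieu M U)) /\
  (Mroot M @ \oo --> +oo ->
     E_Beurling M U = E_Beurling (Mbc M) U /\ is_fun_algebra (E_Beurling M U)).

Proof.
move=> M0 oU; split.
  move=> /limn_einf_gt0[D D0 DM].
  have [c c0 cM] := Mroot_growth M0 D0 DM.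
  have Msup := growth_superexp M0 c0 D0 cM.
  have E : E_Roumieu M U = E_Roumieu (Mbc M) U.
    apply/seteqP; split; first exact: (E_Roumieu_sub_Mbc oU M0 Msup c0 D0 cM).
    exact: (E_Roumieu_Mbc_sub M0 Msup).
  (* The product inequality is available for [Mbc M], so the algebra property is shown there and
     carried over by [E]. *)
  split=> //; rewrite E.
  exact: (E_Roumieu_algebra oU (Mbc_gt0 M0 Msup) (ltW (fact_Mbc_gt0 M0 Msup 0))
            (fact_Mbc_mul M0 Msup)).
move=> /cvgryPge DM.
(* In the Beurling case every [D] is available; superexponential growth is drawn from [D = 1]. *)
have cM (D : R) : 0 < D -> exists2 c, 0 < c & forall k, c * D ^+ k <= M k.
  by move=> D0; exact: (Mroot_growth M0 D0 (DM D)).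
have [c c0 c1M] := cM 1 ltr01.
have Msup := growth_superexp M0 c0 ltr01 c1M.
have E : E_Beurling M U = E_Beurling (Mbc M) U.
  apply/seteqP; split; first exact: (E_Beurling_sub_Mbc oU M0 Msup cM).
  exact: (E_Beurling_Mbc_sub M0 Msup).
split=> //; rewrite E.
exact: (E_Beurling_algebra oU (Mbc_gt0 M0 Msup) (ltW (fact_Mbc_gt0 M0 Msup 0))
          (fact_Mbc_mul M0 Msup)).
Qed.
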